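(* Let $q\ge1$ and let $\widehat f_n^{(block)}$ be a block estimator with the lattice design $V=[\mathbf 1,\mathbf n]$. Assume the $\varepsilon_i$ are independent with $\mathbb E\varepsilon_i=0$ and $\mathbb E|\varepsilon_i|^{q\vee2}\le\sigma^{q\vee2}$, and that $f$ is non-decreasing and piecewise constant on $V$ in the sense that $V=\cup_{k=1}^K[a_k,b_k]$ with $K\le n$ and $f(a_k)=f(b_k)$ for all $k\le K$. Then $$R_q(\widehat{\mathbf f}_n^{(block)},\mathbf f_n)\lesssim_{q,d}\sigma^q\min\bigg\{1,\ n^{-1}\sum_{k=1}^Kn_{a_k,b_k}^{(1-q/2)_+}\Big(\log_+^{s_k}(n_{a_k,b_k})\Big)^{I\{q=2\}}\bigg\}$$ with $s_k=\#\{j:b_{k,j}>a_{k,j}\}$. Moreover, if in addition the blocks $[a_k,b_k]$, $k=1,\ldots,K$, are disjoint, then $$R_q(\widehat{\mathbf f}_n^{(block)},\mathbf f_n)\lesssim_{q,d}\sigma^q\min\bigg\{1,\ \Big(\frac Kn\Big)^{\min\{1,q/2\}}\Big(\log_+^{d_K}(n/K)\Big)^{I\{q=2\}}\bigg\},$$ where $d_K=\max_{1\le k\le K}s_k$.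
   Context: Lattice design: for positive integers $n_1,\ldots,n_d$, $V=[\mathbf 1,\mathbf n]=\prod_{j=1}^d\{1,\ldots,n_j\}$, $n=\prod_jn_j$; the design points $x_1,\ldots,x_n$ enumerate $V$, each once. We observe $y_i=f(x_i)+\varepsilon_i$. Vectors are ordered coordinatewise; for $u\le v$ in $V$, $[u,v]=\{x\in V:u\le x\le v\}$ and $n_{u,v}=\#\{i:x_i\in[u,v]\}$; here $a_k\le b_k$ are points of $V$ with $j$-th coordinates $a_{k,j},b_{k,j}$. $\overline y_{[u,v]}$ is the average of the $y_i$ with $x_i\in[u,v]$. $R_q(\widehat{\mathbf f}_n,\mathbf f_n)=n^{-1}\sum_{i=1}^n\mathbb E|\widehat f_n(x_i)-f(x_i)|^q$. Max-min and min-max estimators: $\widehat f_n^{(max-min)}(x)=\max_{u\le x}\min_{v\ge x}\overline y_{[u,v]}$, $\widehat f_n^{(min-max)}(x)=\min_{v\ge x}\max_{u\le x}\overline y_{[u,v]}$ ($u,v\in V$). A block estimator is any estimator $\widehat f_n^{(block)}$ lying, for every $x\in V$, between the minimum and the maximum of these two. $\log_+x=1\vee\log x$, $\log_+^s(x)=(\log_+x)^s$, $(t)_+=\max(t,0)$, $a\vee b=\max(a,b)$, $I\{\cdot\}$ is an indicator. $A\lesssim_{q,d}B$ means $A\le C_{q,d}B$ with $C_{q,d}$ depending only on $(q,d)$. *)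

(* Defs.v *)
From HB Require Import structures.
From mathcomp Require Import all_boot all_order all_algebra.
From mathcomp Require Import all_classical all_reals all_analysis.

Set Implicit Arguments.
Unset Strict Implicit.
Unset Printing Implicit Defensive.

Import Order.TTheory GRing.Theory Num.Theory.
Import numFieldNormedType.Exports.

Local Open Scope ring_scope.

(* The box {1,...,N_1} x ... x {1,...,N_d}.  As 'I_m is {0,...,m-1}, every    *)
(* coordinate is shifted by one; only order and cardinality are used.         *)
Definition lattice d (N : 'I_d -> nat) := {dffun forall j : 'I_d, 'I_(N j)}.

Definition lattice_size d (N : 'I_d -> nat) : nat := (\prod_(j < d) N j)%N.

Definition lle d (N : 'I_d -> nat) (u v : lattice N) : bool :=
  [forall j, (u j <= v j)%N].

Definition block d (N : 'I_d -> nat) (u v : lattice N) : {set lattice N} :=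
  [set x | lle u x && lle x v].

Section LeastSquaresBlocks.
Context {R : realType} {d : nat} {N : 'I_d -> nat} {m : nat}.
Variable x : 'I_m -> lattice N.

Definition block_count (u v : lattice N) : nat :=
  #|[set i | x i \in block u v]|.

Definition block_mean (y : 'I_m -> R) (u v : lattice N) : R :=
  (\sum_(i < m | x i \in block u v) y i) / (block_count u v)%:R.

(* In each iterated maximum or minimum the initial value is one of the terms, *)
(* the one indexed by z, so that the result is the max or min of the family.  *)
Definition max_min (y : 'I_m -> R) (z : lattice N) : R :=
  let g u := \big[Num.min/block_mean y u z]_(v | lle z v) block_mean y u v in
  \big[Num.max/g z]_(u | lle u z) g u.

Definition min_max (y : 'I_m -> R) (z : lattice N) : R :=
  let h v := \big[Num.max/block_mean y z v]_(u | lle u z) block_mean y u v in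
  \big[Num.min/h z]_(v | lle z v) h v.

End LeastSquaresBlocks.

Definition mutually_independent d (T : measurableType d) (R : realType)
    (P : probability T R) (I : finType) (X : I -> T -> R) : Prop :=
  forall (J : {set I}) (A : I -> set R), (forall i, measurable (A i)) ->
    P (\bigcap_(i in [set` J]) (X i @^-1` A i))%classic =
    (\prod_(i in J) P (X i @^-1` A i)%classic)%E.

(* fhat z is the random value of the estimator at the lattice point z; the    *)
(* responses are f (x i) + eps i.                                             *)
Definition block_estimator (R : realType) d (N : 'I_d -> nat) m
    (x : 'I_m -> lattice N) (T : Type) (f : lattice N -> R)
    (eps : 'I_m -> T -> R) (fhat : lattice N -> T -> R) : Prop :=
  forall (z : lattice N) (w : T),
    let y i := f (x i) + eps i w in
    Num.min (max_min x y z) (min_max x y z) <= fhat z w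
      <= Num.max (max_min x y z) (min_max x y z).

Definition risk dsp (T : measurableType dsp) (R : realType)
    (P : probability T R) d (N : 'I_d -> nat) m (x : 'I_m -> lattice N)
    (q : R) (fhat : lattice N -> T -> R) (f : lattice N -> R) : \bar R :=
  ((m%:R^-1)%:E *
   \sum_(i < m) 'E_P[fun w => (`|fhat (x i) w - f (x i)| `^ q)%R])%E.

Definition log_plus (R : realType) (t : R) : R := Num.max 1 (ln t).

Definition free_dim d (N : 'I_d -> nat) (a b : lattice N) : nat :=
  #|[set j | (a j < b j)%N]|.

(* Main.v *)
Require Import Defs.
From HB Require Import structures.
From mathcomp Require Import all_boot all_order all_algebra.
From mathcomp Require Import all_classical all_reals all_analysis.
From mathcomp Require Import measurable_realfun.
From mathcomp Require Import zify ring lra.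

Set Implicit Arguments.
Unset Strict Implicit.
Unset Printing Implicit Defensive.

Import Order.TTheory GRing.Theory Num.Theory.
Import numFieldNormedType.Exports.

Local Open Scope ring_scope.

(** Let z lie in a block [a, b] on which f is constant.  Choosing v = b in both
    formulas, and using that f <= f b = f z on every box [u, b], shows that the
    max-min and the min-max estimators exceed f z by at most the largest average
    of the errors over the boxes [u, b] with u <= z; choosing u = a bounds the
    deviation downwards by the averages over [a, v] with v >= z
    ([block_estimate_le], [block_estimate_ge]).  Any estimator between the two
    obeys the same bounds.

    The analytic core is thus a maximal inequality: with p = max(q, 2), the p-th
    moment of the largest error average over the boxes containing [z, b] and
    anchored at b is at most C sigma^p #[z, b]^(- p/2).  Up to the constant this
    is the moment of the average over the smallest box [z, b] itself.

    Its proof replaces multiparameter martingales by random signs.  The function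
    to be integrated is a maximum of p-th powers of linear forms, hence convex in
    each error separately; since an error is centred and independent of the
    others, replacing it by plus or minus twice itself, with probability one half
    each, can only increase the expectation ([max_power_symmetrize],
    [symmetrize_moment]).  Once all errors carry random signs, one may fix their
    values and argue on a finite uniform space of signs.  There, reflecting the
    signs beyond a level gives the maximal inequality of Levy, applied to one
    coordinate of the lattice after the other ([levy_maximal], [levy_orthant]),
    and the exponential moments of a Rademacher sum give the inequality of
    Khintchine ([khintchine]).  Finally the boxes are sorted into dyadic shells
    according to the sizes of their sides; the contributions of the shells decay
    geometrically because p >= 2 ([le_average_bound], [average_bound_moment]).

    Interpolating between the exponents p and q, the risk at z is at most
    C sigma^q (#[z, b]^(- q/2) + #[a, z]^(- q/2)) ([pointwise_risk]).  Summed
    over z in [a, b] each term factors into a product over the coordinates of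
    sums of k^(- q/2), of order m^(1 - q/2), log m or 1 according to whether q is
    smaller than, equal to or larger than 2 ([block_sum_depth],
    [block_sum_height]).  A side of length one contributes a factor 1, which is
    why the logarithm is raised to the number of nondegenerate sides only.  For
    disjoint blocks the sizes n_k add up to at most n, so t_k = n_k K / n has mean
    at most 1, and comparing each summand with its value at n_k = n / K costs a
    factor linear in 1 + t_k ([disjoint_terms_le]). *)

(** * Elementary inequalities for powers *)

Section PowerInequalities.
Context {R : realType}.
Implicit Types (p a b t : R).

Lemma ler_powR_base p a b : 0 <= p -> 0 <= a -> a <= b -> a `^ p <= b `^ p.
Proof.
by move=> p0 a0 ab; apply: ge0_ler_powR; rewrite ?nnegrE// (le_trans a0).
Qed.

(** Young's inequality for [a `^ (p - 1)] and [b].  It says that the graph of the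
    p-th power lies above its tangent at [a], which is the form in which
    convexity is used throughout. *)
Lemma powR_tangent p a b : 1 <= p -> 0 <= a -> 0 <= b ->
  p * a `^ (p - 1) * b <= (p - 1) * a `^ p + b `^ p.
Proof.
move=> p1 a0 b0; have p0 : 0 < p by apply: lt_le_trans p1.
have [->|pn1] := eqVneq p 1.
  by rewrite subrr powRr0 mul0r add0r !mul1r powRr1.
have p1' : 0 < p - 1 by rewrite subr_gt0 lt_neqAle eq_sym pn1.
have /= := @conjugate_powR R (a `^ (p - 1)) b (p / (p - 1)) p.
rewrite -powRrM mulrCA mulfV ?gt_eqF// mulr1 => /(_ (powR_ge0 _ _) b0).
have h : (p / (p - 1))^-1 + p^-1 = 1 by rewrite invf_div; field; rewrite !gt_eqF.
move=> /(_ (divr_gt0 p0 p1') p0 h) H.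
rewrite -mulrA -ler_pdivlMl// (le_trans H)// le_eqVlt; apply/orP; left; apply/eqP.
by field; rewrite !gt_eqF.
Qed.

Lemma powR_midpoint p a b : 1 <= p ->
  `|(a + b) / 2| `^ p <= (`|a| `^ p + `|b| `^ p) / 2.
Proof.
move=> p1; have p0 : 0 < p by apply: lt_le_trans p1.
pose m := (`|a| + `|b|) / 2.
have m0 : 0 <= m by rewrite divr_ge0 ?addr_ge0.
apply: (@le_trans _ _ (m `^ p)).
  apply: ler_powR_base; rewrite ?(ltW p0)//. rewrite /m normrM [`|2^-1|]ger0_norm ?invr_ge0//.
  by rewrite ler_pM2r ?invr_gt0// ler_normD.
have h1 := powR_tangent p1 m0 (normr_ge0 a).
have h2 := powR_tangent p1 m0 (normr_ge0 b).
have h3 : m * m `^ (p - 1) = m `^ p by apply: mulr_powRB1.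
have h4 : p * m `^ (p - 1) * `|a| + p * m `^ (p - 1) * `|b| = 2 * p * m `^ p.
  by rewrite -h3 /m; field.
rewrite ler_pdivlMr//; nra.
Qed.

Lemma power_mean (I : finType) (B : {set I}) (c : I -> R) p : 1 <= p ->
  (forall i, 0 <= c i) ->
  (\sum_(i in B) c i) `^ p <= #|B|%:R `^ (p - 1) * \sum_(i in B) c i `^ p.
Proof.
move=> p1 c0; have p0 : 0 < p by apply: lt_le_trans p1.
have [->|B0] := eqVneq B finset.set0.
  by rewrite !big_set0 powR0 ?gt_eqF// mulr0.
have N0 : 0 < #|B|%:R :> R by rewrite ltr0n card_gt0.
set S := \sum_(i in B) c i; set N : R := #|B|%:R.
have S0 : 0 <= S by apply: sumr_ge0.
pose m := S / N; have m0 : 0 <= m by rewrite divr_ge0// ltW.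
have H : \sum_(i in B) (p * m `^ (p - 1) * c i) <=
         \sum_(i in B) ((p - 1) * m `^ p + c i `^ p).
  by apply: ler_sum => i _; exact: powR_tangent.
have h3 : m * m `^ (p - 1) = m `^ p by apply: mulr_powRB1.
rewrite -mulr_sumr big_split/= sumr_const -mulr_natl -/S -/N in H.
have SE : S = N * m by rewrite /m mulrCA mulfV ?mulr1// gt_eqF.
have NE : N `^ p = N `^ (p - 1) * N by rewrite mulrC mulr_powRB1// ltW.
rewrite [X in X `^ p <= _]SE powRM ?(ltW N0)// NE -mulrA ler_wpM2l ?powR_ge0//.
rewrite SE -h3 in H; rewrite -h3; nra.
Qed.

(** The constant 2 in the exponent is not optimal, but makes first-order bounds on
    the exponential sufficient. *)
Lemma cosh_le_expR_sqr t : expR t + expR (- t) <= 2 * expR (2 * t ^+ 2).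
Proof.
wlog t0 : t / 0 <= t => [H|].
  have [/H//|/ltW t0] := leP 0 t.
  by have := H (- t); rewrite opprK sqrrN addrC => ->//; rewrite oppr_ge0.
(* From [t >= 1/2] on, [t <= 2 * t ^+ 2]; below, both exponentials are bounded by
   the inverse of [1 - t] or [1 + t]. *)
have [t2|t2] := leP (2^-1) t.
  have : expR t <= expR (2 * t ^+ 2) by rewrite ler_expR; nra.
  have : expR (- t) <= expR t by rewrite ler_expR; lra.
  lra.
have h1 : expR t <= (1 - t)^-1.
  by rewrite -[expR t]invrK -expRN lef_pV2 ?posrE ?expR_gt0//; [exact: expR_ge1Dx | lra].
have h2 : expR (- t) <= (1 + t)^-1.
  by rewrite expRN lef_pV2 ?posrE ?expR_gt0//; [exact: expR_ge1Dx | lra].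
have h3 := expR_ge1Dx (2 * t ^+ 2).
have h4 : (1 - t)^-1 + (1 + t)^-1 <= 2 * (1 + 2 * t ^+ 2).
  have -> : (1 - t)^-1 + (1 + t)^-1 = 2 / (1 - t ^+ 2).
    by field; apply/and3P; split; rewrite gt_eqF//; nra.
  rewrite ler_pdivrMr; last by nra.
  have : t ^+ 2 <= 4^-1 by nra.
  have : 0 <= t ^+ 2 by rewrite sqr_ge0.
  by set u := t ^+ 2; nra.
lra.
Qed.

(** Raise [t <= p * expR (t / p)] to the power [p]. *)
Lemma powR_le_expR p t : 0 < p -> 0 <= t -> t `^ p <= p `^ p * expR t.
Proof.
move=> p0 t0.
have -> : expR t = expR (t / p) `^ p by rewrite -expRM divfK ?gt_eqF.
rewrite -powRM ?expR_ge0 ?(ltW p0)//; apply: ler_powR_base; rewrite ?(ltW p0)//.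
have := expR_ge1Dx (t / p); rewrite -(ler_pM2l p0) => H.
apply: le_trans H; rewrite mulrDr mulr1 mulrCA mulfV ?gt_eqF// mulr1.
by rewrite lerDr ltW.
Qed.

End PowerInequalities.

(** * Rademacher sums *)

Section Rademacher.
Context {R : realType} {I : finType}.
Implicit Types (a b : I -> R) (r : {ffun I -> bool}).

Definition sgn r i : R := (-1) ^+ r i.

Lemma rademacher_mgf_le b :
  \sum_r expR (\sum_i sgn r i * b i) <=
  2 ^+ #|I| * expR (2 * \sum_i b i ^+ 2).
Proof.
under eq_bigr do rewrite expR_sum.
rewrite -(bigA_distr_bigA (fun i (c : bool) => expR ((-1) ^+ c * b i))).
rewrite mulr_sumr expR_sum -prodr_const -big_split/=.
apply: ler_prod => i _; rewrite sumr_ge0/= => [|c _]; last exact: expR_ge0.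
by rewrite big_bool/= expr0 expr1 mul1r mulN1r addrC cosh_le_expR_sqr.
Qed.

(** After normalizing the sum of squares to 1, [`|x| `^ p] is dominated by a
    multiple of [expR x + expR (- x)], whose mean is bounded by the moment
    generating function.  Means over signs are written as sums over all sign
    vectors, hence the factor [2 ^+ #|I|]. *)
Lemma khintchine p a : 0 < p ->
  \sum_r `|\sum_i sgn r i * a i| `^ p <=
  2 * p `^ p * expR 2 * 2 ^+ #|I| * (\sum_i a i ^+ 2) `^ (p / 2).
Proof.
move=> p0; set Q := \sum_i a i ^+ 2.
have Q0 : 0 <= Q by apply: sumr_ge0 => i _; exact: sqr_ge0.
have [Qz|Qn] := eqVneq Q 0.
  rewrite Qz powR0 ?mulr0 ?gt_eqF ?divr_gt0//.
  rewrite big1// => r _; rewrite big1 ?normr0 ?powR0 ?gt_eqF// => i _.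
  move/eqP: Qz; rewrite psumr_eq0; last by move=> *; exact: sqr_ge0.
  by move=> /allP/(_ i (mem_index_enum i))/=; rewrite sqrf_eq0 => /eqP->; rewrite mulr0.
have Qp : 0 < Q by rewrite lt_neqAle eq_sym Qn.
pose v := Num.sqrt Q; have v0 : 0 < v by rewrite sqrtr_gt0.
have v2 : v ^+ 2 = Q by rewrite sqr_sqrtr.
have vp : Q `^ (p / 2) = v `^ p.
  by rewrite -v2 -powR_mulrn ?ltW// -powRrM mulrCA mulfV ?mulr1.
pose e c : R := \sum_r expR (\sum_i sgn r i * (c * (a i / v))).
have He c : c ^+ 2 = 1 -> e c <= 2 ^+ #|I| * expR 2.
  move=> c1; apply: le_trans (rademacher_mgf_le _) _.
  under eq_bigr do rewrite exprMn c1 mul1r expr_div_n.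
  by rewrite -mulr_suml -/Q v2 divff// mulr1.
have H r : `|\sum_i sgn r i * a i| `^ p <= v `^ p * p `^ p *
   (expR (\sum_i sgn r i * (1 * (a i / v))) + expR (\sum_i sgn r i * (-1 * (a i / v)))).
  set S := \sum_i sgn r i * a i.
  have E1 : \sum_i sgn r i * (1 * (a i / v)) = S / v.
    by rewrite /S mulr_suml; apply: eq_bigr => i _; rewrite mul1r mulrA.
  have E2 : \sum_i sgn r i * (-1 * (a i / v)) = - (S / v).
    by rewrite /S mulr_suml -sumrN; apply: eq_bigr => i _; rewrite mulN1r mulrN mulrA.
  rewrite E1 E2.
  have -> : `|S| = v * `|S / v|.
    by rewrite normrM normfV (gtr0_norm v0) mulrCA mulfV ?mulr1// gt_eqF.
  rewrite powRM ?(ltW v0)// -mulrA ler_wpM2l ?powR_ge0//.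
  apply: (le_trans (powR_le_expR p0 _)) => //; rewrite ler_wpM2l ?powR_ge0//.
  have [S0|S0] := ler0P (S / v).
    by rewrite lerDr expR_ge0.
  by rewrite lerDl expR_ge0.
apply: le_trans (ler_sum _ (fun r _ => H r)) _.
rewrite -mulr_sumr big_split/= vp.
have h1 := He 1 (expr1n _ _).
have h2 : e (-1) <= 2 ^+ #|I| * expR 2 by apply: He; rewrite sqrrN expr1n.
rewrite -/(e 1) -/(e (-1)).
have -> : 2 * p `^ p * expR 2 * 2 ^+ #|I| * v `^ p =
  v `^ p * p `^ p * (2 ^+ #|I| * expR 2 + 2 ^+ #|I| * expR 2) by ring.
by rewrite ler_wpM2l ?mulr_ge0 ?powR_ge0// lerD.
Qed.

End Rademacher.

(** * Maximal inequality over orthants of random signs *)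

Section Levy.
Context {R : realType}.

(** Abstract form of Levy's inequality.  [tau k] reflects everything that happens
    after step [k], so it fixes the first values [X j], and either [Y] or its
    reflection is at least [X k].  With [M k] the running maximum, the mean of
    [M k + 2 (Y - M k)^+] is nonincreasing in [k]: over a point and its reflection,
    raising [M] by [h] up to [X k] adds [2 h] in total, while the positive part
    loses [h], doubled, at the point where [Y] is at least [X k]. *)
Lemma levy_maximal (Om : finType) (n : nat) (tau : nat -> Om -> Om)
    (X : nat -> Om -> R) (Y : Om -> R) :
  (forall k, involutive (tau k)) -> (forall w, 0 <= Y w) ->
  (forall j k w, (j <= k)%N -> X j (tau k w) = X j w) ->
  (forall k w, X k w <= Num.max (Y w) (Y (tau k w))) ->
  \sum_w \big[Num.max/0]_(k < n) X k w <= 2 * \sum_w Y w.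
Proof.
move=> tauK Y0 Xtau XY.
pose M k w : R := \big[Num.max/0]_(j < k) X j w.
pose G k w : R := M k w + 2 * Num.max (Y w - M k w) 0.
suff H : \sum_w G n w <= 2 * \sum_w Y w.
  apply: le_trans H; apply: ler_sum => w _.
  by rewrite /G lerDl mulr_ge0// le_max lexx orbT.
elim: n => [|n IH].
  rewrite mulr_sumr; apply: ler_sum => w _.
  by rewrite /G /M big_ord0 add0r subr0 max_l.
apply: le_trans IH.
have sym F : 2 * \sum_w F w = \sum_w (F w + F (tau n w)).
  rewrite big_split/= [X in _ = _ + X](reindex (tau n)); last first.
    by exists (tau n) => v _; rewrite tauK.
  under [X in _ = _ + X]eq_bigr do rewrite tauK.
  by rewrite mulr2n mulrDl !mul1r.
rewrite -(ler_pM2l (ltr0n _ 2)) !sym; apply: ler_sum => w _.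
have M0 k v : 0 <= M k v by exact: bigmax_ge_id.
have MS k v : M k.+1 v = Num.max (M k v) (X k v).
  apply/le_anti/andP; split.
    apply/bigmax_leP; split => [|[i iS] _]; first by rewrite le_max M0.
    rewrite le_max; have /= := iS; rewrite ltnS leq_eqVlt => /orP[/eqP->|ik].
      by rewrite lexx orbT.
    by rewrite (le_bigmax _ (fun j : 'I_k => X j v) (Ordinal ik)).
  rewrite ge_max; apply/andP; split; last first.
    exact: (le_bigmax _ (fun j : 'I_k.+1 => X j v) ord_max).
  apply/bigmax_leP; split => [|i _]; first exact: M0.
  exact: (le_bigmax _ (fun j : 'I_k.+1 => X j v) (widen_ord (leqnSn k) i)).
have Mtau : M n (tau n w) = M n w.
  by apply: eq_bigr => j _; rewrite Xtau// ltnW.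
rewrite /G !MS Mtau Xtau//.
have := XY n w; set x := X n w; set m := M n w.
set y := Y w; set y' := Y (tau n w).
rewrite /Num.max; do ! case: ifPn; rewrite -?leNgt; lra.
Qed.

Variables (I : finType) (d : nat) (l : I -> 'I_d -> nat) (L : nat).

Let orthant_max (p : R) (b : I -> R) (s : seq 'I_d) (r : {ffun I -> bool}) : R :=
  \big[Num.max/0]_(t : {ffun 'I_d -> 'I_L})
    `|\sum_(i | all (fun j => (l i j < t j)%N) s) sgn r i * b i| `^ p.

(** Induction over the coordinates in [s]: the previous lemma is applied to the
    maximum over the coordinates already treated, each new coordinate costing a
    factor 2. *)
Lemma levy_orthant_seq (p : R) (b : I -> R) (s : seq 'I_d) : 0 <= p ->
  \sum_r orthant_max p b s r <=
  2 ^+ size s * \sum_(r : {ffun I -> bool}) `|\sum_i sgn r i * b i| `^ p.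
Proof.
move=> p0; elim: s => [|j s IH].
  rewrite expr0 mul1r; apply: ler_sum => r _.
  by apply/bigmax_leP; split => [|t _]; rewrite ?powR_ge0.
pose tau k (r : {ffun I -> bool}) := [ffun i => if (l i j < k)%N then r i else ~~ r i].
pose A k (t : {ffun 'I_d -> 'I_L}) r : R :=
  \sum_(i | (l i j < k)%N && all (fun j => (l i j < t j)%N) s) sgn r i * b i.
pose X k r : R := \big[Num.max/0]_(t : {ffun 'I_d -> 'I_L}) `|A k t r| `^ p.
have tauK k : involutive (tau k).
  by move=> r; apply/ffunP => i; rewrite /tau !ffunE; case: (l i j < k)%N; rewrite ?negbK.
have Y0 r : 0 <= orthant_max p b s r by rewrite /orthant_max; exact: bigmax_ge_id.
have Xtau i k r : (i <= k)%N -> X i (tau k r) = X i r.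
  move=> ik; apply: eq_bigr => t _; congr (`|_| `^ _).
  apply: eq_bigr => m /andP[mi _]; congr (_ * _).
  by rewrite /sgn ffunE (leq_trans mi ik).
have XY k r : X k r <= Num.max (orthant_max p b s r) (orthant_max p b s (tau k r)).
  apply/bigmax_leP; split => [|t _]; first by rewrite le_max Y0.
  pose S r : R := \sum_(i | all (fun j => (l i j < t j)%N) s) sgn r i * b i.
  have SY r' : `|S r'| `^ p <= orthant_max p b s r'.
    by exact: (le_bigmax _ (fun u : {ffun 'I_d -> 'I_L} =>
      `|\sum_(i | all (fun j => (l i j < u j)%N) s) sgn r' i * b i| `^ p) t).
  suff : `|A k t r| <= Num.max `|S r| `|S (tau k r)|.
    rewrite !le_max => /orP[]h; apply/orP; [left|right];
    by apply: le_trans (SY _); apply: ler_powR_base.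
  (* The truncated sum is the midpoint of the full sum and its reflection. *)
  have SA : A k t r = (S r + S (tau k r)) / 2.
    rewrite /S -big_split/= (bigID (fun i => l i j < k)%N)/= [X in _ + X]big1 => [|i].
      rewrite addr0 mulr_suml /A; apply: eq_big => [i|i /andP[ij _]].
        by rewrite andbC.
      by rewrite /sgn ffunE ij; field.
    move=> /andP[_ ij]; rewrite /sgn ffunE (negbTE ij) -mulrDl.
    by case: (r i); rewrite /= ?expr0 ?expr1 ?subrr ?addNr mul0r.
  rewrite SA normrM [`|2^-1|]ger0_norm ?invr_ge0// ler_pdivrMr// (le_trans (ler_normD _ _))//.
  have h1 : `|S r| <= Num.max `|S r| `|S (tau k r)| by rewrite le_max lexx.
  have h2 : `|S (tau k r)| <= Num.max `|S r| `|S (tau k r)| by rewrite le_max lexx orbT.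
  by lra.
rewrite [size _]/= exprS -mulrA.
apply: le_trans (ler_wpM2l _ IH) => //.
apply: le_trans (levy_maximal L tauK Y0 Xtau XY).
apply: ler_sum => r _; apply/bigmax_leP; split => [|t _]; first exact: bigmax_ge_id.
apply: (@le_trans _ _ (X (t j) r)); last exact: (le_bigmax _ (fun k : 'I_L => X k r) (t j)).
exact: (le_bigmax _ (fun t => `|A _ t r| `^ p) t).
Qed.

Lemma levy_orthant (p : R) (b : I -> R) : 0 <= p ->
  \sum_(r : {ffun I -> bool}) \big[Num.max/0]_(t : {ffun 'I_d -> 'I_L})
    `|\sum_(i | [forall j, (l i j < t j)%N]) sgn r i * b i| `^ p <=
  2 ^+ d * \sum_(r : {ffun I -> bool}) `|\sum_i sgn r i * b i| `^ p.
Proof.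
move=> p0; have := levy_orthant_seq b (enum 'I_d) p0.
rewrite size_enum_ord; apply: le_trans; apply: ler_sum => r _.
rewrite le_eqVlt; apply/orP; left; apply/eqP; apply: eq_bigr => t _.
congr (`|_| `^ _); apply: eq_bigl => i; apply/forallP/allP => [h j _|h j]; first exact: h.
by apply: (h j); rewrite mem_enum.
Qed.

(** The sum of squares in Khintchine's inequality is turned into a sum of p-th
    powers by the power mean inequality, since only the p-th moments of the
    errors are controlled. *)
Lemma rademacher_orthant_max (p : R) (a : I -> R) (B : {set I}) : 2 <= p ->
  \sum_(r : {ffun I -> bool}) \big[Num.max/0]_(t : {ffun 'I_d -> 'I_L})
    `|\sum_(i in B | [forall j, (l i j < t j)%N]) sgn r i * a i| `^ p <=
  2 ^+ d * (2 * p `^ p * expR 2) * 2 ^+ #|I| *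
    (#|B|%:R `^ (p / 2 - 1) * \sum_(i in B) `|a i| `^ p).
Proof.
move=> p2; have p0 : 0 < p by apply: lt_le_trans p2.
pose b i := if i \in B then a i else 0.
have -> : \sum_(r : {ffun I -> bool}) \big[Num.max/0]_(t : {ffun 'I_d -> 'I_L})
    `|\sum_(i in B | [forall j, (l i j < t j)%N]) sgn r i * a i| `^ p =
  \sum_(r : {ffun I -> bool}) \big[Num.max/0]_(t : {ffun 'I_d -> 'I_L})
    `|\sum_(i | [forall j, (l i j < t j)%N]) sgn r i * b i| `^ p.
  apply: eq_bigr => r _; apply: eq_bigr => t _; congr (`|_| `^ _).
  rewrite big_mkcondl; apply: eq_bigr => i _; rewrite /b; case: ifP => //.
  by rewrite mulr0.
apply: (le_trans (levy_orthant b (ltW p0))).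
rewrite -!mulrA ler_wpM2l ?exprn_ge0//.
apply: (le_trans (khintchine b p0)); rewrite -!mulrA.
do 2 rewrite ler_wpM2l ?powR_ge0//; rewrite ler_wpM2l ?expR_ge0// ler_wpM2l ?exprn_ge0//.
have -> : \sum_i b i ^+ 2 = \sum_(i in B) a i ^+ 2.
  rewrite [RHS]big_mkcond; apply: eq_bigr => i _; rewrite /b; case: ifP => //.
  by rewrite expr0n.
apply: (le_trans (power_mean _ _ _)) => [|i|]; [lra|exact: sqr_ge0|].
rewrite ler_wpM2l ?powR_ge0//; apply: ler_sum => i _.
by rewrite -[a i ^+ 2]real_normK ?num_real// -powR_mulrn// -powRrM mulrCA mulfV ?mulr1.
Qed.

End Levy.

(** * Decoupling of independent variables *)

Section Decoupling.
Context {dsp : measure_display} {T : measurableType dsp} {R : realType}.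
Context {d1 : measure_display} {S1 : measurableType d1}.
Context {d2 : measure_display} {S2 : measurableType d2}.
Variables (P : probability T R) (Z : {RV P >-> S1}) (Y : {RV P >-> S2}).
Hypothesis indep : forall B A, measurable B -> measurable A ->
  P (Z @^-1` B `&` Y @^-1` A)%classic =
  (P (Z @^-1` B)%classic * P (Y @^-1` A)%classic)%E.

Lemma measurable_decoupled (F : S1 * S2 -> \bar R) :
  measurable_fun [set: S1 * S2] F -> (forall z, 0 <= F z)%E ->
  measurable_fun [set: S1] (fun z => \int[P]_v F (z, Y v))%E.
Proof.
move=> mF F0.
have := @measurable_fun_fubini_tonelli_F _ _ S1 S2 R (distribution P Y) F mF F0.
congr (measurable_fun _ _).
apply/funext => w; rewrite /fubini_F ge0_integral_distribution//.
exact: measurableT_comp.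
Qed.

(** The joint law of independent variables is the product of their laws, so an
    independent copy of [Y] may be integrated first, with [Z] fixed. *)
Lemma decoupling (F : S1 * S2 -> \bar R) :
  measurable_fun [set: S1 * S2] F -> (forall z, 0 <= F z)%E ->
  (\int[P]_w F (Z w, Y w) = \int[P]_w \int[P]_v F (Z w, Y v))%E.
Proof.
move=> mF F0.
pose psi (w : T) : S1 * S2 := (Z w, Y w).
have mpsi : measurable_fun [set: T] psi by apply/measurable_fun_pair.
have -> : (\int[P]_w F (Z w, Y w) = \int[pushforward P psi]_z F z)%E.
  by rewrite ge0_integral_pushforward.
rewrite (eq_measure_integral (distribution P Z \x distribution P Y)%E); last first.
  move=> A mA _; apply/esym.
  by apply: product_measure_unique => // B C mB mC /=; exact: indep.
rewrite fubini_tonelli1// ge0_integral_distribution//.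
- apply: eq_integral => w _ /=; rewrite /fubini_F ge0_integral_distribution//.
  exact: measurableT_comp.
- exact: measurable_fun_fubini_tonelli_F.
- by move=> w; exact: integral_ge0.
Qed.

End Decoupling.

Section IndependentOfGenerated.
Context {dsp : measure_display} {T : measurableType dsp} {R : realType}.
Context {d2 : measure_display} {S : measurableType d2}.
Variables (P : probability T R) (Y : {RV P >-> S}) (G : set (set T)).
Hypothesis G_measurable : (G `<=` measurable)%classic.
Hypothesis G_setI : setI_closed G.
Hypothesis G_setT : G [set: T]%classic.
Hypothesis G_indep : forall B A, G B -> measurable A ->
  P (B `&` Y @^-1` A)%classic = (P B * P (Y @^-1` A)%classic)%E.

(** Two finite measures, [B] |-> P (B and Y in A) and P (Y in A) P (B), agree on a
    pi-system, hence on the sigma-algebra which it generates. *)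
Lemma indep_generated B A : <<s G >>%classic B -> measurable A ->
  P (B `&` Y @^-1` A)%classic = (P B * P (Y @^-1` A)%classic)%E.
Proof.
move=> GB mA.
have mYA : measurable (Y @^-1` A)%classic.
  by rewrite -[X in measurable X]setTI; exact: measurable_funPT.
have PYA0 : 0 <= fine (P (Y @^-1` A)%classic) by rewrite fine_ge0.
pose c : {nonneg R} := NngNum PYA0.
have PE : P (Y @^-1` A)%classic = (c%:num)%:E.
  by rewrite /= fineK// fin_num_measure.
rewrite PE muleC.
apply: (@g_sigma_algebra_measure_unique _ R T G G_measurable (fun _ => setT)
   (fun _ => G_setT) _ (mrestr P mYA) (mscale c P) G_setI) => //.
- by apply/seteqP; split => // w _; exists 0%N.
- by move=> D GD; rewrite /= /mrestr /mscale/= G_indep// PE muleC.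
- move=> _; rewrite /= /mrestr setTI; apply: le_lt_trans (probability_le1 _ _) _ => //.
  by rewrite ltry.
Qed.

Lemma measurable_id_generated :
  measurable_fun [set: T] (id : T -> g_sigma_algebraType G).
Proof.
move=> _ B mB; rewrite setTI preimage_id.
have h : (<<s G >> `<=` (measurable : set (set T)))%classic.
  apply: smallest_sub => //; exact: sigma_algebra_measurable.
exact: h.
Qed.

End IndependentOfGenerated.

(** * Symmetrization *)

Section MaxPower.
Context {R : realType} {U : finType}.

Definition max_power (p : R) (c : U -> R) : R := \big[Num.max/0]_u `|c u| `^ p.

Lemma max_power_ge0 p c : 0 <= max_power p c.
Proof. by rewrite /max_power; exact: bigmax_ge_id. Qed.

Lemma le_max_power p c u : `|c u| `^ p <= max_power p c.
Proof. exact: (le_bigmax _ (fun u => `|c u| `^ p) u). Qed.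

Lemma max_power_le p c x : 0 <= x -> (forall u, `|c u| `^ p <= x) ->
  max_power p c <= x.
Proof. by move=> x0 cx; apply/bigmax_leP; split. Qed.

Lemma measurable_max_power d (T : measurableType d) p (f : U -> T -> R) :
  (forall u, measurable_fun [set: T] (f u)) ->
  measurable_fun [set: T] (fun w => max_power p (f ^~ w)).
Proof.
move=> mf; rewrite /max_power; elim: (index_enum U) => [|u s IH].
  by under eq_fun do rewrite big_nil; exact: measurable_cst.
under eq_fun do rewrite big_cons.
apply: measurable_maxr => //.
by apply: (measurableT_comp (measurable_powR p)); exact: measurableT_comp.
Qed.

End MaxPower.

Section Jensen.
Context {dsp : measure_display} {T : measurableType dsp} {R : realType}.
Variables (P : probability T R) (Y : T -> R).
Hypothesis Y_int : P.-integrable [set: T] (EFin \o Y).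
Hypothesis Y_mean : (\int[P]_w (Y w)%:E = 0)%E.

Let mY : measurable_fun [set: T] Y.
Proof. exact/measurable_EFinP/(measurable_int P). Qed.

Let integral_constant (c : R) : (\int[P]_w c%:E = c%:E)%E.
Proof.
apply: etrans (integral_cst P measurableT c%:E) _.
by rewrite -[RHS]mule1; congr (_ * _)%E; exact: probability_setT.
Qed.

Let maffine a b : measurable_fun [set: T] (fun w => a + b * Y w).
Proof. by apply: measurable_funD => //; exact: measurable_funM. Qed.

Let mpow p a b : measurable_fun [set: T] (fun w => `|a + b * Y w| `^ p).
Proof. by apply: (measurableT_comp (measurable_powR p)); exact: measurableT_comp. Qed.

(** Jensen's inequality for the p-th power, by integrating the tangent at [`|a|];
    the integral on the right may be infinite. *)
Lemma jensen_power p a b : 1 <= p ->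
  ((`|a| `^ p)%:E <= \int[P]_w (`|a + b * Y w| `^ p)%:E)%E.
Proof.
move=> p1; have p0 : 0 < p by apply: lt_le_trans p1.
have Iab : P.-integrable [set: T] (fun w => (a + b * Y w)%:E).
  under eq_fun do rewrite EFinD EFinM.
  apply: integrableD => //; first exact: finite_measure_integrable_cst.
  exact: integrableZl.
have Eab : (\int[P]_w (a + b * Y w)%:E = a%:E)%E.
  under eq_integral do rewrite EFinD EFinM.
  rewrite integralD//; first last.
  - exact: integrableZl.
  - exact: finite_measure_integrable_cst.
  rewrite integral_constant integralZl// Y_mean mule0 adde0//.
have h1 : (`|a|%:E <= \int[P]_w `|a + b * Y w|%:E)%E.
  have := le_abse_integral P measurableT (measurable_int _ Iab).
  by rewrite Eab.
set J := (\int[P]_w _)%E.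
pose k := p * `|a| `^ (p - 1).
have k0 : 0 <= k by rewrite mulr_ge0 ?powR_ge0// ltW.
have : (k%:E * \int[P]_w `|a + b * Y w|%:E <= ((p - 1) * `|a| `^ p)%:E + J)%E.
  rewrite -ge0_integralZl//; last by apply/measurable_EFinP; exact: measurableT_comp.
  have -> : (((p - 1) * `|a| `^ p)%:E = \int[P]_w ((p - 1) * `|a| `^ p)%:E)%E.
    by rewrite integral_constant.
  rewrite -ge0_integralD//; first last.
  - exact/measurable_EFinP.
  - by move=> w _; rewrite lee_fin mulr_ge0 ?powR_ge0// subr_ge0.
  apply: ge0_le_integral => //.
  - by move=> w _; rewrite -EFinM lee_fin mulr_ge0.
  - apply: measurable_funeM; apply/measurable_EFinP; exact: measurableT_comp.
  - by apply/emeasurable_funD => //; exact/measurable_EFinP.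
  - move=> w _; rewrite -EFinM -EFinD lee_fin; exact: powR_tangent.
move/(le_trans (lee_wpmul2l _ h1)); rewrite lee_fin => /(_ k0).
have -> : (k%:E * `|a|%:E = ((p - 1) * `|a| `^ p)%:E + (`|a| `^ p)%:E)%E.
  rewrite -EFinM -EFinD; congr EFin.
  rewrite /k -mulrA [_ `^ (p - 1) * _]mulrC mulr_powRB1//; ring.
by rewrite leeD2lE.
Qed.

(** A convex function [phi] satisfies [phi y <= (phi (2 y) + phi 0) / 2], and
    [phi 0] is at most the mean of [phi (- 2 Y)] because [Y] is centred.  Here
    [phi] is a maximum of p-th powers of affine functions. *)
Lemma max_power_symmetrize (U : finType) p (a b : U -> R) : 1 <= p ->
  (\int[P]_w (max_power p (fun u => a u + b u * Y w)%R)%:E <=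
   2^-1%:E * (\int[P]_w (max_power p (fun u => a u + 2 * b u * Y w)%R)%:E +
              \int[P]_w (max_power p (fun u => a u + - 2 * b u * Y w)%R)%:E))%E.
Proof.
move=> p1; have p0 : 0 < p by apply: lt_le_trans p1.
pose f b' w := (max_power p (fun u => a u + b' u * Y w))%:E.
have mf b' : measurable_fun [set: T] (f b').
  by apply/measurable_EFinP; apply: measurable_max_power.
have f0 b' w : (0 <= f b' w)%E by rewrite lee_fin max_power_ge0.
have Ja : ((max_power p a)%:E <= \int[P]_w f (fun u => - 2 * b u)%R w)%E.
  rewrite /max_power; elim/big_ind: _ => [|x y hx hy|u _].
  - by apply: integral_ge0 => w _.
  - by rewrite EFin_max ge_max hx hy.
  apply: le_trans (jensen_power (a u) (- 2 * b u) p1) _.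
  apply: ge0_le_integral => //; first exact/measurable_EFinP.
  move=> w _; rewrite lee_fin.
  exact: (le_max_power p (fun v => a v + - 2 * b v * Y w)).
have H : (\int[P]_w f b w <=
   2^-1%:E * (\int[P]_w f (fun u => 2 * b u)%R w + (max_power p a)%:E))%E.
  have -> : ((max_power p a)%:E = \int[P]_w (max_power p a)%:E)%E.
    by rewrite integral_constant.
  rewrite -ge0_integralD//; last by move=> w _; rewrite lee_fin max_power_ge0.
  rewrite -ge0_integralZl//; last by move=> w _; rewrite adde_ge0// lee_fin max_power_ge0.
    apply: ge0_le_integral => //.
      by apply: measurable_funeM; apply: emeasurable_funD.
    move=> w _; rewrite -EFinD -EFinM lee_fin.
    apply: max_power_le => [|u].
      by rewrite mulr_ge0 ?invr_ge0// addr_ge0 ?max_power_ge0.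
    have -> : a u + b u * Y w = ((a u + 2 * b u * Y w) + a u) / 2 by field.
    apply: le_trans (powR_midpoint _ _ p1) _.
    rewrite mulrC ler_wpM2l ?invr_ge0// lerD ?le_max_power//.
  by apply: emeasurable_funD.
apply: le_trans H _; rewrite lee_wpmul2l ?lee_fin ?invr_ge0//.
exact: leeD2l.
Qed.

End Jensen.

Section SignAverage.
Context {R : realType} {I : finType}.
Local Open Scope ereal_scope.
Implicit Types J : {ffun I -> bool} -> \bar R.

Definition sign_average J : \bar R := (2 ^- #|I|)%:E * \sum_r J r.

Definition sign_flip (i : I) (r : {ffun I -> bool}) : {ffun I -> bool} :=
  [ffun k => if k == i then ~~ r k else r k].

Lemma sign_average_cst (x : \bar R) : sign_average (fun=> x) = x.
Proof.
rewrite /sign_average (eq_bigr (fun=> 1%:E * x)) => [|r _]; last by rewrite mul1e.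
rewrite -ge0_sume_distrl// sumEFin sumr_const card_ffun card_bool.
by rewrite muleA -EFinM natrX mulVf ?mul1e// expf_neq0.
Qed.

Lemma le_sign_average J J' : (forall r, J r <= J' r) ->
  sign_average J <= sign_average J'.
Proof.
move=> JJ'; apply: lee_wpmul2l; first by rewrite lee_fin invr_ge0 exprn_ge0.
exact: lee_sum.
Qed.

Lemma sign_average_flip i J : (forall r, 0 <= J r) ->
  sign_average (fun r => 2^-1%:E * (J r + J (sign_flip i r))) = sign_average J.
Proof.
move=> J0.
have flipK : involutive (sign_flip i).
  by move=> r; apply/ffunP => k; rewrite !ffunE; case: eqP; rewrite ?negbK.
rewrite /sign_average -ge0_sume_distrr; last by move=> r _; exact: adde_ge0.
rewrite big_split/= [X in _ + X](reindex (sign_flip i))/=; last first.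
  by exists (sign_flip i) => r _; rewrite flipK.
under [X in _ + X]eq_bigr do rewrite flipK.
by set S := \sum_r _; rewrite -mule2n -mule_natl muleA -EFinM mulVf// mul1e.
Qed.

Variable U : Type.

Definition rescale (i : I) (s : R) (c : U -> I -> R) : U -> I -> R :=
  fun u k => if k == i then (s * c u k)%R else c u k.

(** Coordinates are symmetrized one at a time; [w s r] is the family in which those
    in [s] have already received the signs [r]. *)
Lemma sign_average_iterate (M : (U -> I -> R) -> \bar R) (c : U -> I -> R) :
  (forall c, 0 <= M c) ->
  (forall c i, M c <= 2^-1%:E * (M (rescale i 2 c) + M (rescale i (- 2) c))) ->
  M c <= sign_average (fun r => M (fun u k => 2 * sgn r k * c u k)%R).
Proof.
move=> M0 step.
pose w (s : seq I) (r : {ffun I -> bool}) u k :=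
  if k \in s then (2 * sgn r k * c u k)%R else c u k.
have -> : (fun r => M (fun u k => 2 * sgn r k * c u k)%R) =
    (fun r => M (w (enum I) r)).
  apply/funext => r; congr M.
  by apply/funext => u; apply/funext => k; rewrite /w mem_enum.
elim: (enum I) (enum_uniq I) => [_|i s IH /= /andP[iNs us]].
  by rewrite -[leLHS]sign_average_cst; exact: le_sign_average.
apply: le_trans (IH us) _; rewrite -(sign_average_flip i (fun r => M0 (w (i :: s) r))).
apply: le_sign_average => r.
have E (b : bool) : rescale i (2 * (-1) ^+ b) (w s r) =
    w (i :: s) (if r i == b then r else sign_flip i r).
  apply/funext => u; apply/funext => k; rewrite /rescale /w inE.
  have [->|ki] := eqVneq k i; rewrite /= ?eqxx ?(negbTE iNs).
    rewrite /sgn; case: eqP => [->//|/eqP rb]; rewrite /sign_flip ffunE eqxx.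
    by case: (r i) b rb => -[].
  case: ifP => // _; rewrite /sgn; case: eqP => // _.
  by rewrite /sign_flip ffunE (negbTE ki).
have := step (w s r) i.
have := E false; have := E true; rewrite expr0 expr1 mulrN1 mulr1 => -> ->.
by case: (r i); rewrite ?eqxx //= addeC.
Qed.

End SignAverage.

Section Symmetrization.
Context {dsp : measure_display} {T : measurableType dsp} {R : realType}.
Variables (P : probability T R) (I : finType) (X : I -> {RV P >-> R}).
Hypothesis X_indep : mutually_independent P (fun i => X i : T -> R).

(** A pi-system generating the sigma-algebra of the variables other than [X i]. *)
Definition cylinders (i : I) : set (set T) :=
  [set B | exists A : I -> set R, (forall k, measurable (A k)) /\
     B = (\bigcap_(k in [set` [set~ i]%SET]) X k @^-1` A k)%classic]%classic.

Let mpre k (A : set R) : measurable A -> measurable (X k @^-1` A)%classic.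
Proof. by move=> mA; rewrite -[X in measurable X]setTI; exact: measurable_funPT. Qed.

Lemma cylinders_measurable i : (cylinders i `<=` measurable)%classic.
Proof.
move=> B [A [mA ->]].
apply: fin_bigcap_measurable => [|k _]; first exact: finite_finset.
exact: mpre.
Qed.

Lemma cylinders_setI i : setI_closed (cylinders i).
Proof.
move=> _ _ [A [mA ->]] [B [mB ->]]; exists (fun k => A k `&` B k)%classic; split.
  by move=> k; exact: measurableI.
by rewrite -bigcapI.
Qed.

Lemma cylinders_setT i : cylinders i [set: T]%classic.
Proof.
exists (fun=> setT); split => //; apply/seteqP; split => // w _ k _ //.
Qed.

Lemma cylinders_preimage i k A : k != i -> measurable A ->
  cylinders i (X k @^-1` A)%classic.
Proof.
move=> ki mA; exists (fun j => if j == k then A else setT); split.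
  by move=> j; case: ifP.
apply/seteqP; split => [w Aw j _ /=|w /(_ k)/=].
  by case: eqP => // ->.
rewrite eqxx => Hw; have : (k \in [set~ i]) by rewrite !inE.
exact: Hw.
Qed.

Lemma cylinders_indep i B A : cylinders i B -> measurable A ->
  P (B `&` X i @^-1` A)%classic = (P B * P (X i @^-1` A)%classic)%E.
Proof.
move=> [D [mD ->]] mA.
pose D' k := if k == i then A else D k.
have mD' k : measurable (D' k) by rewrite /D'; case: ifP.
have -> : (\bigcap_(k in [set` [set~ i]%SET]) X k @^-1` D k `&` X i @^-1` A)%classic
   = (\bigcap_(k in [set` [set: I]%SET]) X k @^-1` D' k)%classic.
  apply/seteqP; split => [w [Dw Aw] k _|w Dw].
    rewrite /= /D'; case: eqP => [->//|/eqP ki]; apply: Dw.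
    by rewrite /= !inE.
  split => [k /=|]; last by have := Dw i (finset.in_setT i); rewrite /= /D' eqxx.
  rewrite !inE => ki; have := Dw k (finset.in_setT k).
  by rewrite /= /D' (negbTE ki).
rewrite (X_indep [set: I]%SET mD') (X_indep [set~ i] mD).
rewrite (bigD1 i) ?inE//= {1}/D' eqxx muleC; congr (_ * _)%E.
apply: eq_big => [k|k]; rewrite !inE//= => ki.
by rewrite /D' (negbTE ki).
Qed.

Hypothesis X_int : forall i, P.-integrable [set: T] (EFin \o X i).
Hypothesis X_mean : forall i, (\int[P]_w (X i w)%:E = 0)%E.

Variables (U : finType) (p : R).
Hypothesis p1 : 1 <= p.
Implicit Types c : U -> I -> R.

Definition max_moment c : \bar R :=
  (\int[P]_w (max_power p (fun u => \sum_k c u k * X k w)%R)%:E)%E.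

(** Integrate first over [X i], the other variables being fixed: this is the
    one-variable inequality. *)
Lemma symmetrize_coordinate c i : (max_moment c <= 2^-1%:E *
  (max_moment (rescale i 2 c) + max_moment (rescale i (- 2) c)))%E.
Proof.
pose T' := g_sigma_algebraType (cylinders i).
have mid : measurable_fun [set: T] (id : T -> T').
  exact: (measurable_id_generated (@cylinders_measurable i)).
pose Z : {mfun T >-> T'} := HB.pack (id : T -> T')
  (isMeasurableFun.Build _ _ _ _ (id : T -> T') mid).
pose a u (w : T) := \sum_(k | k != i) c u k * X k w.
pose F s (z : T' * R) : \bar R :=
  (max_power p (fun u => a u z.1 + s * c u i * z.2))%:E.
have F0 s z : (0 <= F s z)%E by rewrite lee_fin max_power_ge0.
have ma u : measurable_fun [set: T'] (a u).
  rewrite /a; under eq_fun do rewrite big_mkcond.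
  apply: measurable_sum => k; case: (boolP (k != i)) => [ki|_]; last exact: measurable_cst.
  apply: measurable_funM => // _ A mA; rewrite setTI.
  by apply: sub_sigma_algebra; exact: cylinders_preimage.
have mF s : measurable_fun [set: T' * R] (F s).
  apply/measurable_EFinP; apply: measurable_max_power => u.
  apply: measurable_funD; first exact: measurableT_comp.
  by apply: measurable_funM => //; exact: measurable_cst.
have indepZ (B : set T') (A : set R) : measurable B -> measurable A ->
  P (Z @^-1` B `&` X i @^-1` A)%classic =
  (P (Z @^-1` B)%classic * P (X i @^-1` A)%classic)%E.
  move=> mB mA; apply: (indep_generated _ _ _ (@cylinders_indep i)) => //.
  - exact: cylinders_measurable.
  - exact: cylinders_setI.
  - exact: cylinders_setT.
have split_sum s u w :
    \sum_k rescale i s c u k * X k w = a u w + s * c u i * X i w.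
  rewrite (bigD1 i)//= {1}/rescale eqxx addrC; congr (_ + _).
  by apply: eq_bigr => k ki; rewrite /rescale (negbTE ki).
have momentE s : max_moment (rescale i s c) = (\int[P]_w \int[P]_v F s (w, X i v))%E.
  rewrite -(decoupling indepZ (mF s) (F0 s)).
  by apply: eq_integral => w _; rewrite /F/=; congr (max_power _ _)%:E; apply/funext => u.
have -> : max_moment c = max_moment (rescale i 1 c).
  congr max_moment; apply/funext => u; apply/funext => k.
  by rewrite /rescale mul1r; case: ifP.
rewrite !momentE.
have mI s : measurable_fun [set: T] (fun w => \int[P]_v F s (w : T', X i v))%E.
  by apply: (measurableT_comp (measurable_decoupled (X i) (mF s) (F0 s)) mid).
have I0 s w : (0 <= \int[P]_v F s (w, X i v))%E by exact: integral_ge0.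
rewrite -ge0_integralD// -ge0_integralZl//; last 2 first.
- exact: emeasurable_funD.
- by move=> w _; exact: adde_ge0.
apply: ge0_le_integral => //.
  by apply: measurable_funeM; exact: emeasurable_funD.
move=> w _; rewrite /F/=.
have := max_power_symmetrize (X_int i) (X_mean i) (a ^~ w) (c ^~ i) p1.
apply: le_trans; rewrite le_eqVlt; apply/orP; left; apply/eqP.
by apply: eq_integral => v _; congr (max_power _ _)%:E; apply/funext => u; rewrite mul1r.
Qed.

Lemma symmetrize_moment c : (max_moment c <=
  sign_average (fun r => max_moment (fun u k => 2 * sgn r k * c u k)%R))%E.
Proof.
apply: sign_average_iterate => [c'|]; last exact: symmetrize_coordinate.
by apply: integral_ge0 => v _; rewrite lee_fin max_power_ge0.
Qed.

End Symmetrization.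

(** * Maximal inequality for averages *)

Section ProductPower.
Context {R : realType}.

Lemma powR_prod (J : Type) (s : seq J) (x : J -> R) (r : R) :
  (forall j, 0 <= x j) -> (\prod_(j <- s) x j) `^ r = \prod_(j <- s) x j `^ r.
Proof.
move=> x0; elim: s => [|j s IH]; first by rewrite !big_nil powR1.
by rewrite !big_cons powRM// ?IH// prodr_ge0.
Qed.

Lemma sum_half_powers L : \sum_(e < L) (2^-1 : R) ^+ e <= 2.
Proof.
have -> : \sum_(e < L) (2^-1 : R) ^+ e = 2 - 2 * 2^-1 ^+ L.
  elim: L => [|L IH]; first by rewrite big_ord0 expr0 mulr1 subrr.
  by rewrite big_ord_recr/= IH exprS; field.
by rewrite lerBlDr lerDl mulr_ge0// exprn_ge0// invr_ge0.
Qed.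

End ProductPower.

Section MaximalAverages.
Context {dsp : measure_display} {T : measurableType dsp} {R : realType}.
Variables (P : probability T R) (I : finType) (X : I -> {RV P >-> R}).
Hypothesis X_indep : mutually_independent P (fun i => X i : T -> R).
Hypothesis X_int : forall i, P.-integrable [set: T] (EFin \o X i).
Hypothesis X_mean : forall i, (\int[P]_w (X i w)%:E = 0)%E.
Variables (p sigma : R).
Hypothesis p2 : 2 <= p.
Hypothesis X_moment : forall i,
  (\int[P]_w (`|X i w| `^ p)%:E <= (sigma `^ p)%:E)%E.
Variables (d : nat) (l : I -> 'I_d -> nat).

(** Product of the constants of Levy's and Khintchine's inequalities, and of the
    factor due to doubling the variables in the symmetrization. *)
Definition box_const : R := 2 ^+ d * (2 * p `^ p * expR 2) * 2 `^ p.

Lemma box_const_ge0 : 0 <= box_const.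
Proof. by rewrite /box_const !mulr_ge0 ?powR_ge0 ?expR_ge0 ?exprn_ge0. Qed.

Let p0 : 0 < p. Proof. exact: lt_le_trans p2. Qed.
Let p1 : 1 <= p. Proof. by apply: le_trans p2; rewrite ler1n. Qed.

Definition box_max L (B : {set I}) (w : T) : R :=
  max_power p (fun t : {ffun 'I_d -> 'I_L} =>
    \sum_(i in B | [forall j, (l i j < t j)%N]) X i w).

Lemma box_maxE L (B : {set I}) w : box_max L B w =
  max_power p (fun t : {ffun 'I_d -> 'I_L} =>
    \sum_i ((i \in B) && [forall j, (l i j < t j)%N])%:R * X i w).
Proof.
congr max_power; apply/funext => t; rewrite big_mkcond; apply: eq_bigr => i _.
by case: ifP => _; rewrite ?mul1r ?mul0r.
Qed.

Lemma measurable_box_max L B : measurable_fun [set: T] (box_max L B).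
Proof.
have -> : box_max L B = fun w => max_power p (fun t : {ffun 'I_d -> 'I_L} =>
    \sum_i ((i \in B) && [forall j, (l i j < t j)%N])%:R * X i w).
  by apply/funext => w; exact: box_maxE.
apply: measurable_max_power => t; apply: measurable_sum => i.
by apply: measurable_funM => //; exact: measurable_cst.
Qed.

Let mXp i : measurable_fun [set: T] (fun w => `|X i w| `^ p).
Proof. by apply: (measurableT_comp (measurable_powR p)); exact: measurableT_comp. Qed.

Let sum_moment (B : {set I}) (k : R) : 0 <= k ->
  (\int[P]_w (k * \sum_(i in B) `|X i w| `^ p)%:E <=
     (k * (#|B|%:R * sigma `^ p))%:E)%E.
Proof.
move=> k0; under eq_integral do rewrite EFinM -sumEFin big_mkcond.
rewrite ge0_integralZl//; first last.
- by move=> w _; apply: sume_ge0 => i _; case: ifP => // _; rewrite lee_fin powR_ge0.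
- apply: emeasurable_sum => i; case: (i \in B); last exact: measurable_cst.
  exact/measurable_EFinP.
rewrite EFinM lee_wpmul2l// ge0_integral_sum//; first last.
- by move=> i w _; case: ifP => // _; rewrite lee_fin powR_ge0.
- move=> i; case: (i \in B); last exact: measurable_cst.
  exact/measurable_EFinP.
have -> : ((#|B|%:R * sigma `^ p)%:E = \sum_i (if i \in B then (sigma `^ p)%:E else 0))%E.
  by rewrite -big_mkcond/= sumEFin sumr_const mulr_natl.
by apply: lee_sum => i _; case: (i \in B) => //; rewrite integral0.
Qed.

Lemma box_max_moment L (B : {set I}) (M : nat) : (#|B| <= M)%N ->
  (\int[P]_w (box_max L B w)%:E <=
     (box_const * M%:R `^ (p / 2) * sigma `^ p)%:E)%E.
Proof.
move=> BM.
pose c (t : {ffun 'I_d -> 'I_L}) i : R := ((i \in B) && [forall j, (l i j < t j)%N])%:R.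
have -> : (\int[P]_w (box_max L B w)%:E = max_moment X p c)%E.
  by apply: eq_integral => w _; rewrite box_maxE.
apply: le_trans (symmetrize_moment X_indep X_int X_mean p1 c) _.
pose K : R := 2 ^+ d * (2 * p `^ p * expR 2) * #|B|%:R `^ (p / 2 - 1).
have K0 : 0 <= K by rewrite !mulr_ge0 ?powR_ge0 ?expR_ge0 ?exprn_ge0.
pose f r w : R := max_power p (fun t => \sum_k 2 * sgn r k * c t k * X k w).
have mf r : measurable_fun [set: T] (fun w => (f r w)%:E).
  apply/measurable_EFinP; apply: measurable_max_power => t.
  by apply: measurable_sum => i; apply: measurable_funM => //; exact: measurable_cst.
have f0 r w : (0 <= (f r w)%:E)%E by rewrite lee_fin max_power_ge0.
have pointwise w : 2 ^- #|I| * \sum_r f r w <=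
    K * 2 `^ p * \sum_(i in B) `|X i w| `^ p.
  rewrite ler_pdivrMl ?exprn_gt0//.
  have := rademacher_orthant_max l L (fun i => 2 * X i w) B p2.
  have -> : \sum_r f r w = \sum_(r : {ffun I -> bool})
      \big[Num.max/0]_(t : {ffun 'I_d -> 'I_L})
    `|\sum_(i in B | [forall j, (l i j < t j)%N]) sgn r i * (2 * X i w)| `^ p.
    apply: eq_bigr => r _; apply: eq_bigr => t _; congr (`|_| `^ _).
    rewrite [RHS]big_mkcond; apply: eq_bigr => i _; rewrite /c.
    by case: ifP => _; rewrite ?(mulr1,mulr0,mul0r)//; ring.
  move/le_trans; apply; rewrite le_eqVlt; apply/orP; left; apply/eqP.
  have -> : \sum_(i in B) `|2 * X i w| `^ p = 2 `^ p * \sum_(i in B) `|X i w| `^ p.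
    rewrite mulr_sumr; apply: eq_bigr => i _.
    by rewrite normrM powRM// ger0_norm.
  by rewrite /K; ring.
rewrite /sign_average /max_moment -ge0_integral_sum//; last by move=> r w _; exact: f0.
rewrite -ge0_integralZl//; last 2 first.
- exact: emeasurable_sum.
- by move=> w _; apply: sume_ge0 => r _; exact: f0.
apply: le_trans (_ : _ <= \int[P]_w (K * 2 `^ p * \sum_(i in B) `|X i w| `^ p)%:E)%E _.
  apply: ge0_le_integral => //.
  - move=> w _; apply: mule_ge0; first by rewrite lee_fin invr_ge0 exprn_ge0.
    by apply: sume_ge0 => r _; exact: f0.
  - by apply: measurable_funeM; exact: emeasurable_sum.
  - apply/measurable_EFinP; apply: measurable_funM; first exact: measurable_cst.
    under eq_fun do rewrite big_mkcond.
    by apply: measurable_sum => i; case: (i \in B); [|exact: measurable_cst].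
  by move=> w _; rewrite sumEFin -EFinM lee_fin; exact: pointwise.
apply: le_trans (sum_moment _ _) _; first by rewrite mulr_ge0 ?powR_ge0.
rewrite lee_fin.
have -> : K * 2 `^ p * (#|B|%:R * sigma `^ p) =
   box_const * #|B|%:R `^ (p / 2) * sigma `^ p.
  by rewrite -(@mulr_powRB1 _ #|B|%:R (p / 2)) ?divr_gt0// /K /box_const; ring.
rewrite ler_wpM2r ?powR_ge0// ler_wpM2l//.
  by rewrite !mulr_ge0 ?powR_ge0 ?expR_ge0 ?exprn_ge0.
by apply: ler_powR_base; rewrite ?ler_nat// divr_ge0// ltW.
Qed.

Variable D : {set I}.
Hypothesis D_count : forall t : 'I_d -> nat,
  (#|[set i in D | [forall j, (l i j < t j)%N]]%SET| <= \prod_j t j)%N.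
Variables (m : 'I_d -> nat) (L : nat).
Hypothesis m_gt0 : forall j, (0 < m j)%N.

(** In each coordinate, [2 `^ (p / 2)] arises because sides within a dyadic class
    vary by a factor 2, and 2 bounds the geometric series over the classes. *)
Definition average_const : R := box_const * (2 * 2 `^ (p / 2)) ^+ d.

(** The variables that can enter a sum all of whose side lengths satisfy
    [2 ^ e j * m j <= t j < 2 ^ (e j).+1 * m j]. *)
Definition shell (e : {ffun 'I_d -> 'I_L}) : {set I} :=
  [set i in D | [forall j, (l i j < 2 ^ (e j).+1 * m j)%N]]%SET.

(** Bounding a maximum over all sizes by a sum over dyadic size classes; within a
    class the normalization is replaced by its smallest value. *)
Definition average_bound (w : T) : R :=
  \sum_(e : {ffun 'I_d -> 'I_L})
    (\prod_j (2 ^ e j * m j)%:R) `^ (- p) * box_max L (shell e) w.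

Lemma average_bound_ge0 w : 0 <= average_bound w.
Proof. by apply: sumr_ge0 => e _; rewrite mulr_ge0 ?powR_ge0 ?max_power_ge0. Qed.

Lemma measurable_average_bound : measurable_fun [set: T] average_bound.
Proof.
apply: measurable_sum => e; apply: measurable_funM; first exact: measurable_cst.
exact: measurable_box_max.
Qed.

(** The size [t] belongs to the class [e j = log2 (t j / m j)], rounded down. *)
Lemma le_average_bound (t : 'I_d -> nat) w : (forall j, m j <= t j < L)%N ->
  (`|\sum_(i in D | [forall j, (l i j < t j)%N]) X i w| / (\prod_j t j)%:R) `^ p
  <= average_bound w.
Proof.
move=> mtL.
have eL j : (trunc_log 2 (t j %/ m j) < L)%N.
  have /andP[mt tL] := mtL j; apply: leq_ltn_trans tL.
  apply: leq_trans (leq_div (t j) (m j)).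
  apply: leq_trans (trunc_logP (ltnSn 1) _); last by rewrite divn_gt0.
  exact/ltnW/ltn_expl.
pose e := [ffun j => Ordinal (eL j)].
have he j : (2 ^ e j * m j <= t j < 2 ^ (e j).+1 * m j)%N.
  rewrite ffunE/=; have /andP[mt tL] := mtL j.
  rewrite -leq_divRL// -ltn_divLR//.
  by rewrite trunc_logP ?divn_gt0//= trunc_log_ltn.
have tL j : (t j < L)%N by case/andP: (mtL j).
pose u : {ffun 'I_d -> 'I_L} := [ffun j => Ordinal (tL j)].
apply: (@le_trans _ _ ((\prod_j (2 ^ e j * m j)%:R) `^ (- p) * box_max L (shell e) w)); last first.
  rewrite /average_bound (bigD1 e)//= lerDl sumr_ge0// => f _.
  by rewrite mulr_ge0 ?powR_ge0 ?max_power_ge0.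
have pos : 0 < \prod_j (2 ^ e j * m j)%:R :> R.
  by apply: prodr_gt0 => j _; rewrite ltr0n muln_gt0 expn_gt0 m_gt0.
have le_t : \prod_j (2 ^ e j * m j)%:R <= (\prod_j t j)%:R :> R.
  rewrite natr_prod; apply: ler_prod => j _.
  by rewrite ler0n ler_nat; case/andP: (he j).
have -> : \sum_(i in D | [forall j, (l i j < t j)%N]) X i w =
  \sum_(i in shell e | [forall j, (l i j < u j)%N]) X i w.
  apply: eq_bigl => i; rewrite inE -andbA; congr (_ && _).
  have -> : [forall j, (l i j < u j)%N] = [forall j, (l i j < t j)%N].
    by apply: eq_forallb => j; rewrite ffunE.
  case: (boolP [forall j, (l i j < t j)%N]); rewrite ?andbF// andbT => /forallP h.
  apply/esym/forallP => j; apply: leq_trans (h j) _.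
  by apply: ltnW; case/andP: (he j).
rewrite powRM// ?invr_ge0// mulrC; apply: ler_pM; rewrite ?powR_ge0//.
  have -> : ((\prod_j t j)%:R^-1 : R) `^ p = ((\prod_j t j)%:R `^ p)^-1.
    by rewrite -powR_inv1// -powRrM mulN1r powRN.
  rewrite powRN lef_pV2 ?posrE ?powR_gt0//; last exact: lt_le_trans le_t.
  by apply: ler_powR_base => //; exact: ltW.
exact: (le_max_power p (fun t : {ffun 'I_d -> 'I_L} =>
    \sum_(i in shell e | [forall j, (l i j < t j)%N]) X i w)).
Qed.

(** A class [e] contributes its normalization to the power [- p] times its
    cardinality to the power [p / 2], that is [2 ^+ e j] to the power [- p / 2]
    in each coordinate, and the sum over all [e] factors into geometric series. *)
Lemma average_bound_moment : (\int[P]_w (average_bound w)%:E <=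
  (average_const * (sigma `^ p * (\prod_j m j)%:R `^ (- (p / 2))))%:E)%E.
Proof.
under eq_integral do rewrite -sumEFin.
rewrite ge0_integral_sum//; first last.
- by move=> e w _; rewrite lee_fin mulr_ge0 ?powR_ge0 ?max_power_ge0.
- move=> e; apply/measurable_EFinP; apply: measurable_funM; first exact: measurable_cst.
  exact: measurable_box_max.
pose g (e : nat) (mj : nat) : R := (2 ^ e * mj)%:R `^ (- p) * (2 ^ e.+1 * mj)%:R `^ (p / 2).
apply: (@le_trans _ _ (\sum_(e : {ffun 'I_d -> 'I_L})
   (box_const * sigma `^ p * \prod_j g (e j) (m j))%:E)%E).
  apply: lee_sum => e _; under eq_integral do rewrite EFinM.
  rewrite ge0_integralZl//; first last.
  - by rewrite lee_fin powR_ge0.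
  - by move=> w _; rewrite lee_fin max_power_ge0.
  - by apply/measurable_EFinP; exact: measurable_box_max.
  apply: le_trans (lee_wpmul2l _ (box_max_moment L (D_count _))) _.
    by rewrite lee_fin powR_ge0.
  rewrite -EFinM lee_fin natr_prod !powR_prod// big_split/=.
  by rewrite le_eqVlt; apply/orP; left; apply/eqP; ring.
rewrite sumEFin lee_fin -mulr_sumr.
rewrite -(bigA_distr_bigA (fun j (e : 'I_L) => g e (m j))).
have -> : average_const * (sigma `^ p * (\prod_j m j)%:R `^ (- (p / 2))) =
    box_const * sigma `^ p *
    ((2 * 2 `^ (p / 2)) ^+ d * (\prod_j m j)%:R `^ (- (p / 2))).
  by rewrite /average_const; ring.
rewrite ler_wpM2l ?mulr_ge0 ?box_const_ge0 ?powR_ge0//.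
have -> : (2 * 2 `^ (p / 2)) ^+ d = \prod_(j < d) (2 * 2 `^ (p / 2)) :> R.
  by rewrite prodr_const card_ord.
rewrite natr_prod powR_prod// -big_split/=.
apply: ler_prod => j _; apply/andP; split.
  by apply: sumr_ge0 => e _; rewrite mulr_ge0 ?powR_ge0.
have gE (e : 'I_L) : g e (m j) <= 2 `^ (p / 2) * (m j)%:R `^ (- (p / 2)) * 2^-1 ^+ e.
  set x : R := (2 ^ e * m j)%:R.
  have x0 : 0 < x by rewrite ltr0n muln_gt0 expn_gt0 m_gt0.
  have -> : g e (m j) = 2 `^ (p / 2) * x `^ (- (p / 2)).
    have -> : g e (m j) = x `^ (- p) * (2 * x) `^ (p / 2).
      by rewrite /g expnS -mulnA -natrM.
    rewrite powRM ?(ltW x0)// mulrCA; congr (_ * _).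
    rewrite -powRD; last by rewrite (gt_eqF x0) implybT.
    by congr (_ `^ _); field.
  rewrite -mulrA ler_wpM2l ?powR_ge0// /x natrM powRM// mulrC ler_wpM2l ?powR_ge0//.
  rewrite natrX -powR_mulrn// -powRrM mulrN powRN exprVn -powR_mulrn//.
  rewrite lef_pV2 ?posrE ?powR_gt0// ler_powR ?ler1n//.
  by rewrite ler_peMr// ler_pdivlMr// mul1r.
apply: le_trans (ler_sum _ (fun e _ => gE e)) _.
rewrite -mulr_sumr [leRHS](_ : _ = 2 `^ (p / 2) * (m j)%:R `^ (- (p / 2)) * 2); last by ring.
by rewrite ler_wpM2l ?mulr_ge0 ?powR_ge0// sum_half_powers.
Qed.

End MaximalAverages.

(** * Geometry of the blocks *)

Section CountingLevels.

Lemma card_ord_interval n (lo hi : nat) : (hi < n)%N ->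
  #|[set k : 'I_n | (lo <= k <= hi)%N]| = (hi.+1 - lo)%N.
Proof.
move=> hn; rewrite cardE -(size_map val) -(size_iota lo (hi.+1 - lo)).
apply/perm_size/uniq_perm.
- by rewrite map_inj_uniq ?enum_uniq//; exact: val_inj.
- exact: iota_uniq.
move=> k; rewrite mem_iota; apply/mapP/idP => [[i]|].
  rewrite mem_enum inE => /andP[loi ihi] ->/=.
  by rewrite loi/= subnKC ?ltnS// ?(leq_trans loi)// (leq_trans ihi).
case/andP=> lok; have [hlo|lohi] := leqP hi.+1 lo.
  by rewrite (eqP hlo) addn0 => /leq_trans/(_ lok); rewrite ltnn.
rewrite (subnKC (ltnW lohi)) ltnS => khi.
by exists (Ordinal (leq_ltn_trans khi hn)) => //; rewrite mem_enum inE/= lok.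
Qed.

Lemma card_levels (I : finType) d (D : {set I}) (l : I -> 'I_d -> nat)
    (t : 'I_d -> nat) :
  {in D &, forall i k, (forall j, l i j = l k j) -> i = k} ->
  (#|[set i in D | [forall j, (l i j < t j)%N]]| <= \prod_j t j)%N.
Proof.
move=> l_inj; set B := finset _.
pose g i : {dffun forall j, 'I_(t j).-1.+1} := [ffun j => inord (l i j)].
have lt_l i j : i \in B -> (l i j < (t j).-1.+1)%N /\ (0 < t j)%N.
  rewrite inE => /andP[_ /forallP/(_ j) h].
  have t0 : (0 < t j)%N by exact: leq_ltn_trans h.
  by rewrite prednK.
have [->|[i0 i0B]] := set_0Vmem B; first by rewrite cards0.
have g_inj : {in B &, injective g}.
  move=> i k iB kB gik; apply: l_inj => [||j].
  - by move: iB; rewrite inE => /andP[].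
  - by move: kB; rewrite inE => /andP[].
  have [li _] := lt_l i j iB; have [lk _] := lt_l k j kB.
  have : val (g i j) = val (g k j) by rewrite gik.
  by rewrite !ffunE/= !inordK.
rewrite -(card_in_imset g_inj); apply: leq_trans (max_card _) _.
rewrite -cardsT (_ : [set: _]%SET = setXn (fun j => [set: 'I_(t j).-1.+1]%SET)).
  rewrite cardsXn; apply: leq_prod => j _; rewrite cardsT card_ord.
  by have [_ t0] := lt_l i0 j i0B; rewrite prednK.
by apply/setP => h; rewrite !inE; apply/esym/familyP => j; rewrite inE.
Qed.

End CountingLevels.

Section Blocks.
Context {R : realType} {d : nat} {N : 'I_d -> nat} {n : nat}.
Variable x : 'I_n -> lattice N.
Hypothesis x_bij : bijective x.
Implicit Types (u v z a b : lattice N).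

Definition side u v (j : 'I_d) : nat := ((v j).+1 - u j)%N.

Lemma lle_refl u : lle u u.
Proof. by apply/forallP => j. Qed.

Lemma lle_trans v u z : lle u v -> lle v z -> lle u z.
Proof.
move=> /forallP uv /forallP vz; apply/forallP => j; exact: leq_trans (uv j) (vz j).
Qed.

Lemma side_gt0 u v j : lle u v -> (0 < side u v j)%N.
Proof. by move=> /forallP/(_ j) uv; rewrite subn_gt0. Qed.

Lemma side_ltn u v j : (side u v j < (\sum_k N k).+1)%N.
Proof.
rewrite ltnS (bigD1 j)//=; apply: leq_trans (leq_addr _ _).
by apply: leq_trans (leq_subr _ _) _; exact: ltn_ord.
Qed.

Lemma card_block u v : #|block u v| = (\prod_j side u v j)%N.
Proof.
have -> : block u v = setXn (fun j => [set k : 'I_(N j) | (u j <= k <= v j)%N]%SET).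
  apply/setP => z; rewrite in_setXn inE; apply/andP/forallP => [[/forallP uz /forallP zv] j|h].
    by rewrite inE uz zv.
  by split; apply/forallP => j; have := h j; rewrite inE => /andP[].
by rewrite cardsXn; apply: eq_bigr => j _; exact: card_ord_interval.
Qed.

Lemma block_countE u v : block_count x u v = #|block u v|.
Proof.
rewrite /block_count -(card_imset _ (bij_inj x_bij)); congr #|pred_of_set _|.
apply/setP => z; apply/imsetP/idP => [[i]|zb]; first by rewrite inE => ? ->.
have [y xy yx] := x_bij; exists (y z); rewrite ?yx// inE yx//.
Qed.

Lemma block_count_gt0 u v : lle u v -> (0 < block_count x u v)%N.
Proof.
by move=> uv; rewrite block_countE card_block prodn_gt0// => j; exact: side_gt0.
Qed.

Lemma block_meanD (y e : 'I_n -> R) u v :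
  block_mean x (fun i => y i + e i) u v = block_mean x y u v + block_mean x e u v.
Proof. by rewrite /block_mean big_split/= mulrDl. Qed.

Lemma block_mean_le (y : 'I_n -> R) u v c : lle u v ->
  (forall i, x i \in block u v -> y i <= c) -> block_mean x y u v <= c.
Proof.
move=> uv yc; rewrite /block_mean ler_pdivrMr ?ltr0n ?block_count_gt0//.
apply: le_trans (ler_sum _ yc) _; rewrite sumr_const mulr_natr.
by rewrite /block_count cardsE.
Qed.

Lemma block_meanN (y : 'I_n -> R) u v :
  block_mean x (fun i => - y i) u v = - block_mean x y u v.
Proof. by rewrite /block_mean sumrN mulNr. Qed.

Lemma block_mean_ge (y : 'I_n -> R) u v c : lle u v ->
  (forall i, x i \in block u v -> c <= y i) -> c <= block_mean x y u v.
Proof.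
move=> uv yc; rewrite -lerN2 -block_meanN; apply: block_mean_le => // i /yc.
by rewrite lerN2.
Qed.

Variables (f : lattice N -> R) (e : 'I_n -> R).
Hypothesis f_mono : forall u v, lle u v -> f u <= f v.
Let y i := f (x i) + e i.

(** Only the term [v = b] of the minimum over [v] is used, and on [u, b] the signal
    is at most [f b = f z]. *)
Lemma block_estimate_le z b M : lle z b -> f b = f z ->
  (forall u, lle u z -> block_mean x e u b <= M) ->
  Num.max (max_min x y z) (min_max x y z) <= f z + M.
Proof.
move=> zb fbz eM.
have yM u : lle u z -> block_mean x y u b <= f z + M.
  move=> uz; rewrite block_meanD lerD ?eM// -fbz.
  apply: block_mean_le; first exact: lle_trans uz zb.
  by move=> i; rewrite inE => /andP[_ /f_mono].
rewrite ge_max; apply/andP; split.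
  have gM u : lle u z ->
      \big[Num.min/block_mean x y u z]_(v | lle z v) block_mean x y u v <= f z + M.
    move=> uz; apply: le_trans (yM u uz).
    exact: (bigmin_le_cond _ (fun v => block_mean x y u v) zb).
  by apply/bigmax_leP; split; [apply: gM; exact: lle_refl | move=> u; exact: gM].
apply: (@le_trans _ _
   (\big[Num.max/block_mean x y z b]_(u | lle u z) block_mean x y u b)).
  exact: (bigmin_le_cond _ (fun v =>
    \big[Num.max/block_mean x y z v]_(u | lle u z) block_mean x y u v) zb).
by apply/bigmax_leP; split; [apply: yM; exact: lle_refl | move=> u; exact: yM].
Qed.

(** Mirror image of the preceding lemma, with the term [u = a] of the maximum. *)
Lemma block_estimate_ge z a M : lle a z -> f a = f z ->
  (forall v, lle z v -> - M <= block_mean x e a v) ->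
  f z - M <= Num.min (max_min x y z) (min_max x y z).
Proof.
move=> az faz eM.
have yM v : lle z v -> f z - M <= block_mean x y a v.
  move=> zv; rewrite block_meanD lerD ?eM// -faz.
  apply: block_mean_ge; first exact: lle_trans az zv.
  by move=> i; rewrite inE => /andP[/f_mono].
rewrite le_min; apply/andP; split.
  apply: (@le_trans _ _
     (\big[Num.min/block_mean x y a z]_(v | lle z v) block_mean x y a v)).
    by apply/bigmin_geP; split; [apply: yM; exact: lle_refl | move=> v; exact: yM].
  exact: (@le_bigmax_cond _ _ _ _ a (fun u => lle u z) (fun u =>
    \big[Num.min/block_mean x y u z]_(v | lle z v) block_mean x y u v) az).
have hM v : lle z v ->
    f z - M <= \big[Num.max/block_mean x y z v]_(u | lle u z) block_mean x y u v.
  move=> zv; apply: le_trans (yM v zv) _.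
  exact: (@le_bigmax_cond _ _ _ _ a (fun u => lle u z) (fun u => block_mean x y u v) az).
by apply/bigmin_geP; split; [apply: hM; exact: lle_refl | move=> v; exact: hM].
Qed.

End Blocks.

(** * Risk at one design point *)

(** Split according to whether [W] exceeds [tau `^ p]: either way
    [W `^ (q / p)] is at most [tau `^ q + tau `^ (q - p) * W].  When [tau = 0],
    [W] vanishes almost everywhere. *)
Lemma interpolate_moment dsp (T : measurableType dsp) (R : realType)
    (P : probability T R) (W : T -> R) (q p C tau : R) :
  measurable_fun [set: T] W -> (forall w, 0 <= W w) ->
  0 < q -> q <= p -> 0 <= C -> 0 <= tau ->
  (\int[P]_w (W w)%:E <= (C * tau `^ p)%:E)%E ->
  (\int[P]_w (W w `^ (q / p))%:E <= ((1 + C) * tau `^ q)%:E)%E.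
Proof.
move=> mW W0 q0 qp C0 tau0 EW; have p0 : 0 < p by exact: lt_le_trans qp.
have mWq : measurable_fun [set: T] (fun w => W w `^ (q / p)).
  exact: (measurableT_comp (measurable_powR _)).
have int_cst c : (\int[P]_w c%:E = c%:E)%E.
  apply: etrans (integral_cst P measurableT c%:E) _.
  by rewrite -[RHS]mule1; congr (_ * _)%E; exact: probability_setT.
have [tau_eq0|tau_neq0] := eqVneq tau 0.
  have EW0 : (\int[P]_w `|(W w)%:E| = 0)%E.
    under eq_integral do rewrite gee0_abs ?lee_fin//.
    apply/eqP; rewrite eq_le integral_ge0 ?andbT// => [|w _]; last by rewrite lee_fin.
    by apply: le_trans EW _; rewrite tau_eq0 powR0 ?gt_eqF// mulr0.
  have ae0 : {ae P, forall w, [set: T]%classic w -> (W w)%:E = 0%E}.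
    by apply/(ae_eq_integral_abs P measurableT) => //; exact/measurable_EFinP.
  rewrite (ae_eq_integral (cst 0%E))//.
  - by rewrite integral0 lee_fin mulr_ge0 ?powR_ge0 ?addr_ge0.
  - exact/measurable_EFinP.
  - apply: filterS ae0 => w h _; have [->] := h I.
    by rewrite powR0// gt_eqF// divr_gt0.
have {}tau0 : 0 < tau by rewrite lt_neqAle eq_sym tau_neq0.
have step w : W w `^ (q / p) <= tau `^ q + tau `^ (q - p) * W w.
  have [Wle|Wgt] := leP (W w) (tau `^ p).
    have : W w `^ (q / p) <= tau `^ q.
      rewrite (_ : tau `^ q = (tau `^ p) `^ (q / p)).
        by apply: ler_powR_base => //; rewrite divr_ge0// ltW.
      by rewrite -powRrM mulrCA mulfV ?mulr1// gt_eqF.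
    by move=> /le_trans; apply; rewrite lerDl mulr_ge0 ?powR_ge0.
  have Wpos : 0 < W w by apply: le_lt_trans Wgt; exact: powR_ge0.
  apply: (@le_trans _ _ (tau `^ (q - p) * W w)); last by rewrite lerDr powR_ge0.
  rewrite -(@mulr_powRB1 _ (W w) (q / p)) ?divr_gt0// mulrC ler_wpM2r//.
  have -> : q / p - 1 = - ((p - q) / p) by field; rewrite gt_eqF.
  have -> : q - p = - (p - q) by rewrite opprB.
  rewrite !powRN lef_pV2 ?posrE ?powR_gt0//.
  rewrite (_ : tau `^ (p - q) = (tau `^ p) `^ ((p - q) / p)).
    by apply: ler_powR_base; [rewrite divr_ge0 ?subr_ge0// ltW|exact: powR_ge0|exact: ltW].
  by rewrite -powRrM mulrCA mulfV ?mulr1// gt_eqF.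
apply: (@le_trans _ _ (\int[P]_w ((tau `^ q)%:E + (tau `^ (q - p))%:E * (W w)%:E))%E).
  apply: ge0_le_integral => //.
  - by move=> w _; rewrite lee_fin powR_ge0.
  - exact/measurable_EFinP.
  - by apply: emeasurable_funD => //; apply: measurable_funeM; exact/measurable_EFinP.
  - by move=> w _; rewrite -EFinM -EFinD lee_fin.
rewrite ge0_integralD//; first last.
- by apply: measurable_funeM; exact/measurable_EFinP.
- by move=> w _; rewrite -EFinM lee_fin mulr_ge0 ?powR_ge0.
- by move=> w _; rewrite lee_fin powR_ge0.
rewrite int_cst ge0_integralZl//; first last.
- by rewrite lee_fin powR_ge0.
- by move=> w _; rewrite lee_fin.
- exact/measurable_EFinP.
apply: (@le_trans _ _ ((tau `^ q)%:E + (tau `^ (q - p))%:E * (C * tau `^ p)%:E)%E).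
  by rewrite leeD2l// lee_wpmul2l// lee_fin powR_ge0.
rewrite -EFinM -EFinD lee_fin mulrCA -powRD; last by rewrite (gt_eqF tau0) implybT.
by rewrite subrK mulrDl mul1r.
Qed.

Section PointwiseRisk.
Context {R : realType} {d : nat} {N : 'I_d -> nat} {n : nat}.
Context {dsp : measure_display} {T : measurableType dsp}.
Variables (P : probability T R) (q sigma : R).
Hypotheses (q1 : 1 <= q) (sigma0 : 0 <= sigma).
Variables (x : 'I_n -> lattice N) (eps : 'I_n -> {RV P >-> R}).
Hypothesis x_bij : bijective x.
Hypothesis eps_indep : mutually_independent P (fun i => eps i : T -> R).
Hypothesis eps_mean : forall i, ('E_P[eps i] = 0)%E.

Let p : R := Num.max q 2.
Let p2 : 2 <= p. Proof. by rewrite /p le_max lexx orbT. Qed.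
Let qp : q <= p. Proof. by rewrite /p le_max lexx. Qed.
Let p0 : 0 < p. Proof. exact: lt_le_trans p2. Qed.

Hypothesis eps_moment : forall i,
  ('E_P[fun w => (`|eps i w| `^ p)%R] <= (sigma `^ p)%:E)%E.

Definition block_volume (u v : lattice N) : R := (\prod_j side u v j)%:R.

Let eps_integral i : (\int[P]_w (eps i w)%:E = 0)%E.
Proof. by rewrite -(eps_mean i) unlock. Qed.

Let eps_integral_pow i : (\int[P]_w (`|eps i w| `^ p)%:E <= (sigma `^ p)%:E)%E.
Proof. by have := eps_moment i; rewrite unlock. Qed.

Let eps_integrable i : P.-integrable [set: T] (EFin \o eps i).
Proof.
have mabs : measurable_fun [set: T] (fun w => `|eps i w|).
  exact: measurableT_comp.
have mpow : measurable_fun [set: T] (fun w => `|eps i w| `^ p).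
  exact: (measurableT_comp (measurable_powR p)).
apply/integrableP; split; first exact/measurable_EFinP.
apply: (@le_lt_trans _ _ (\int[P]_w (1 + (`|eps i w| `^ p)%:E))%E).
  apply: ge0_le_integral => //.
  - exact/measurable_EFinP.
  - by apply: emeasurable_funD => //; exact/measurable_EFinP.
  - move=> w _; rewrite /= -EFinD lee_fin.
    have [h|h] := leP `|eps i w| 1.
      by apply: le_trans h _; rewrite lerDl powR_ge0.
    apply: (@le_trans _ _ (`|eps i w| `^ p)); last by rewrite lerDr.
    by apply: le1r_powR; [exact: ltW | apply: le_trans p2; rewrite ler1n].
rewrite ge0_integralD//; last exact/measurable_EFinP.
apply: lte_add_pinfty.
  by rewrite integral_cst// mul1e; apply: le_lt_trans (probability_le1 _ _) _; rewrite ?ltry.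
by apply: le_lt_trans (eps_integral_pow i) _; rewrite ltry.
Qed.

(** The cutoff on side lengths exceeds all those of the lattice. *)
Let deviation (D : {set 'I_n}) (l : 'I_n -> 'I_d -> nat) (m : 'I_d -> nat) :=
  average_bound eps p l D m (\sum_k N k).+1.

(** The interpolation level is [sigma * #block `^ (- 1/2)], the order of magnitude of
    the average over the smallest box. *)
Let deviation_moment (D : {set 'I_n}) (l : 'I_n -> 'I_d -> nat) (m : 'I_d -> nat) :
  {in D &, forall i k, (forall j, l i j = l k j) -> i = k} ->
  (forall j, 0 < m j)%N ->
  (\int[P]_w (deviation D l m w `^ (q / p))%:E <=
   ((1 + average_const p d) * (sigma `^ q * (\prod_j m j)%:R `^ (- (q / 2))))%:E)%E.
Proof.
move=> l_inj m0; set V : R := (\prod_j m j)%:R.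
have V0 : 0 <= V by rewrite ler0n.
have E (r : R) : sigma `^ r * V `^ (- (r / 2)) = (sigma * V `^ (- 2^-1)) `^ r.
  by rewrite powRM ?powR_ge0// -powRrM; congr (_ * _ `^ _); field.
rewrite E; apply: interpolate_moment => //.
- exact: measurable_average_bound.
- by move=> w; exact: average_bound_ge0.
- exact: lt_le_trans q1.
- by rewrite /average_const !mulr_ge0 ?box_const_ge0 ?exprn_ge0 ?mulr_ge0 ?powR_ge0.
- by rewrite mulr_ge0 ?powR_ge0.
rewrite -E; apply: average_bound_moment => //.
by move=> t; exact: card_levels.
Qed.

(** Boxes anchored at their upper corner [b] are orthants for the depth below [b],
    and boxes anchored at their lower corner [a] are orthants for the height
    above [a]; this makes one maximal inequality serve both directions. *)
Let below b : {set 'I_n} := [set i | lle (x i) b]%SET.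
Let depth (b : lattice N) (i : 'I_n) (j : 'I_d) : nat := (b j - x i j)%N.
Let above a : {set 'I_n} := [set i | lle a (x i)]%SET.
Let height (a : lattice N) (i : 'I_n) (j : 'I_d) : nat := (x i j - a j)%N.

Let depth_inj b :
  {in below b &, forall i k, (forall j, depth b i j = depth b k j) -> i = k}.
Proof.
move=> i k; rewrite !inE => /forallP ib /forallP kb h.
apply: (bij_inj x_bij); apply/ffunP => j; apply: val_inj => /=.
by have := h j; have := ib j; have := kb j; rewrite /depth; lia.
Qed.

Let height_inj a :
  {in above a &, forall i k, (forall j, height a i j = height a k j) -> i = k}.
Proof.
move=> i k; rewrite !inE => /forallP ai /forallP ak h.
apply: (bij_inj x_bij); apply/ffunP => j; apply: val_inj => /=.
by have := h j; have := ai j; have := ak j; rewrite /height; lia.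
Qed.

Let root_bound (S V W : R) : 0 <= V -> (`|S| / V) `^ p <= W -> `|S / V| <= W `^ p^-1.
Proof.
move=> V0 h; rewrite normrM normfV (ger0_norm V0).
have SV0 : 0 <= `|S| / V by rewrite divr_ge0.
rewrite -[leLHS]powRr1// -(mulfV (lt0r_neq0 p0)) powRrM.
by apply: ler_powR_base; rewrite ?invr_ge0 ?powR_ge0// ltW.
Qed.

Let mean_le_depth z b u w : lle z b -> lle u z ->
  `|block_mean x (fun i => eps i w) u b| <=
     deviation (below b) (depth b) (side z b) w `^ p^-1.
Proof.
move=> zb uz; have ub : lle u b by exact: lle_trans zb.
rewrite /block_mean (block_countE x_bij) card_block.
apply: root_bound; first exact: ler0n.
have -> : \sum_(i < n | x i \in block u b) eps i w =
    \sum_(i in below b | [forall j, (depth b i j < side u b j)%N]) eps i w.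
  apply: eq_bigl => i; rewrite !inE andbC; case: (boolP (lle (x i) b)) => //= /forallP ib.
  apply/forallP/forallP => h j; have := h j; have := ib j;
  have /forallP/(_ j) := ub; rewrite /depth /side; clear; lia.
apply: le_average_bound => [//|j|j]; first exact: side_gt0.
rewrite side_ltn andbT /side.
by have /forallP/(_ j) := uz; lia.
Qed.

Let mean_le_height z a v w : lle a z -> lle z v ->
  `|block_mean x (fun i => eps i w) a v| <=
     deviation (above a) (height a) (side a z) w `^ p^-1.
Proof.
move=> az zv; have av : lle a v by exact: lle_trans zv.
rewrite /block_mean (block_countE x_bij) card_block.
apply: root_bound; first exact: ler0n.
have -> : \sum_(i < n | x i \in block a v) eps i w =
    \sum_(i in above a | [forall j, (height a i j < side a v j)%N]) eps i w.
  apply: eq_bigl => i; rewrite !inE; case: (boolP (lle a (x i))) => //= /forallP ai.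
  apply/forallP/forallP => h j; have := h j; have := ai j;
  have /forallP/(_ j) := av; rewrite /height /side; clear; lia.
apply: le_average_bound => [//|j|j]; first exact: side_gt0.
rewrite side_ltn andbT /side.
by have /forallP/(_ j) := zv; lia.
Qed.

Variables (f : lattice N -> R) (fhat : lattice N -> {RV P >-> R}).
Hypothesis f_mono : forall u v, lle u v -> f u <= f v.
Hypothesis fhat_block : block_estimator x f (fun i => eps i : T -> R)
  (fun z => fhat z : T -> R).

(** Upward deviations are governed by the boxes between [z] and [b], downward ones
    by those between [a] and [z]; [p]-th roots turn the maximal bounds on p-th
    powers back into bounds on the averages. *)
Lemma pointwise_risk a b z : f a = f b -> z \in block a b ->
  ('E_P[fun w => (`|fhat z w - f z| `^ q)%R] <=
   ((1 + average_const p d) *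
    (sigma `^ q * (block_volume z b `^ (- (q / 2)) +
                   block_volume a z `^ (- (q / 2)))))%:E)%E.
Proof.
move=> fab; rewrite inE => /andP[az zb].
have faz : f a = f z by apply/le_anti; rewrite f_mono//= fab f_mono.
have fbz : f b = f z by rewrite -fab.
pose Wb := deviation (below b) (depth b) (side z b).
pose Wa := deviation (above a) (height a) (side a z).
have mW (D : {set 'I_n}) (l : 'I_n -> 'I_d -> nat) (m : 'I_d -> nat) :
    measurable_fun [set: T] (fun w => (deviation D l m w `^ (q / p))%:E).
  apply/measurable_EFinP; apply: (measurableT_comp (measurable_powR _)).
  exact: measurable_average_bound.
have step w : `|fhat z w - f z| `^ q <= Wb w `^ (q / p) + Wa w `^ (q / p).
  have /andP[lo hi] := fhat_block z w.
  have {}hi : fhat z w <= f z + Wb w `^ p^-1.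
    apply: le_trans hi _; apply: (block_estimate_le x_bij f_mono zb fbz) => u uz.
    by apply: le_trans (ler_norm _) _; exact: mean_le_depth.
  have {}lo : f z - Wa w `^ p^-1 <= fhat z w.
    apply: le_trans lo; apply: (block_estimate_ge x_bij f_mono az faz) => v zv.
    by rewrite lerNl; apply: le_trans (ler_norm _) _; rewrite normrN; exact: mean_le_height.
  have q0 : 0 <= q by exact: le_trans q1.
  rewrite [q / p]mulrC !powRrM.
  move: (Wb w `^ p^-1) (Wa w `^ p^-1) hi lo => B A hi lo.
  have [h|h] := ger0P (fhat z w - f z).
    apply: (@le_trans _ _ (B `^ q)); last by rewrite lerDl powR_ge0.
    by apply: ler_powR_base => //; rewrite lerBlDl.
  apply: (@le_trans _ _ (A `^ q)); last by rewrite lerDr powR_ge0.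
  apply: ler_powR_base => //; first by rewrite oppr_ge0 ltW.
  by rewrite opprB lerBlDr -lerBlDl.
rewrite unlock.
apply: (@le_trans _ _ (\int[P]_w ((Wb w `^ (q / p))%:E + (Wa w `^ (q / p))%:E))%E).
  apply: ge0_le_integral => //.
  - apply/measurable_EFinP; apply: (measurableT_comp (measurable_powR q)).
    by apply: measurableT_comp => //; apply: measurable_funB.
  - by apply: emeasurable_funD; exact: mW.
  - by move=> w _; rewrite -EFinD lee_fin.
rewrite ge0_integralD//; [|by move=> w _; rewrite lee_fin powR_ge0|exact: mW|
  by move=> w _; rewrite lee_fin powR_ge0|exact: mW].
rewrite !mulrDr EFinD; apply: leeD; apply: deviation_moment.
- exact: depth_inj.
- by move=> j; exact: side_gt0.
- exact: height_inj.
- by move=> j; exact: side_gt0.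
Qed.

End PointwiseRisk.

(** * Harmonic sums and the truncated logarithm *)

Section HarmonicSums.
Context {R : realType}.
Implicit Types (s : R) (m k : nat).

(** Telescoping comparison with the primitive [x `^ (1 - s) / (1 - s)], whose
    increments are bounded by the tangent inequality for the exponent
    [(1 - s)^-1], applied to [x `^ (1 - s)]. *)
Lemma sum_powR_lt1 s m : 0 <= s < 1 ->
  \sum_(k < m) k.+1%:R `^ (- s) <= (1 - s)^-1 * m%:R `^ (1 - s).
Proof.
case/andP=> s0 s1; have th0 : 0 < 1 - s by rewrite subr_gt0.
elim: m => [|m IH]; first by rewrite big_ord0 mulr_ge0 ?invr_ge0 ?powR_ge0// ltW.
rewrite big_ord_recr/=; set x : R := m.+1%:R; set y : R := m%:R.
have x0 : 0 < x by rewrite ltr0n.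
have xn0 : x != 0 by rewrite gt_eqF.
have tn0 : 1 - s != 0 by rewrite gt_eqF.
have th1 : 1 <= (1 - s)^-1 by rewrite invf_ge1// lerBlDr lerDl.
have := powR_tangent th1 (powR_ge0 x (1 - s)) (powR_ge0 y (1 - s)).
rewrite -!powRrM !mulfV// !powRr1 ?ler0n//.
have -> : (1 - s) * ((1 - s)^-1 - 1) = s by field.
have xy : x = y + 1 by rewrite /x /y -natr1.
have -> : ((1 - s)^-1 - 1) * x + y = (1 - s)^-1 * x - 1 by rewrite xy; ring.
move=> H.
suff : x `^ (- s) <= (1 - s)^-1 * x `^ (1 - s) - (1 - s)^-1 * y `^ (1 - s).
  by move: IH; rewrite -/y; lra.
have xs0 : 0 < x `^ s by rewrite powR_gt0.
rewrite -(ler_pM2l xs0) powRN mulfV ?gt_eqF// mulrBr.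
have -> : x `^ s * ((1 - s)^-1 * x `^ (1 - s)) = (1 - s)^-1 * x.
  rewrite mulrCA -powRD ?xn0 ?implybT//.
  by rewrite [s + _]addrC subrK powRr1// ltW.
by rewrite [x `^ s * _]mulrCA mulrA; lra.
Qed.

Lemma invS_le_ln m : (0 < m)%N ->
  (m.+1%:R^-1 : R) <= ln m.+1%:R - ln m%:R.
Proof.
move=> m0; rewrite -lerN2 opprB -ln_div ?posrE ?ltr0n//.
have -> : (m%:R / m.+1%:R : R) = 1 + - m.+1%:R^-1.
  by rewrite -[in LHS](addrK 1 m%:R) natr1 mulrBl mulfV// mul1r.
apply: le_ln1Dx; rewrite ltrN2 invf_lt1 ?ltr0n// ltr1n ltnS//.
Qed.

Lemma sum_powR_eq1 m : (0 < m)%N ->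
  \sum_(k < m) (k.+1%:R : R) `^ (- 1) <= 1 + ln m%:R.
Proof.
elim: m => // -[|m] IH _.
  by rewrite big_ord_recr big_ord0/= powR1 ln1 add0r addr0.
rewrite big_ord_recr/= powR_inv1 ?ler0n//.
apply: le_trans (lerD (IH isT) (@invS_le_ln m.+1 isT)) _.
by rewrite addrA addrAC addrK.
Qed.

(** Telescoping again; here the increments of [x `^ (1 - s)] are bounded by writing
    the power as an exponential and using [invS_le_ln]. *)
Lemma sum_powR_gt1 s m : 1 < s ->
  \sum_(k < m) k.+1%:R `^ (- s) <= 1 + (s - 1)^-1.
Proof.
move=> s1; have th0 : 0 < s - 1 by rewrite subr_gt0.
case: m => [|m]; first by rewrite big_ord0 addr_ge0// invr_ge0 ltW.
suff : \sum_(k < m.+1) k.+1%:R `^ (- s) <=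
    1 + (s - 1)^-1 - (s - 1)^-1 * m.+1%:R `^ (1 - s).
  move=> /le_trans; apply; rewrite lerBlDr lerDl mulr_ge0 ?powR_ge0//.
  by rewrite invr_ge0 ltW.
elim: m => [|m IH].
  by rewrite big_ord_recr big_ord0/= !powR1 mulr1 addrK add0r.
rewrite big_ord_recr/=; set x : R := m.+2%:R.
set y : R := m.+1%:R in IH *.
have x0 : 0 < x by rewrite ltr0n.
have y0 : 0 < y by rewrite ltr0n.
have xy : x = y + 1 by rewrite /x /y -natr1.
suff : (s - 1) * x `^ (- s) <= y `^ (1 - s) - x `^ (1 - s).
  rewrite -ler_pdivlMl// mulrBr; move: IH; lra.
have -> : x `^ (- s) = x `^ (1 - s) * x^-1.
  rewrite -[x^-1]powR_inv1 ?(ltW x0)// -powRD; last by rewrite (gt_eqF x0) implybT.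
  by congr (_ `^ _); ring.
have -> : y `^ (1 - s) = x `^ (1 - s) * expR ((s - 1) * (ln x - ln y)).
  rewrite /powR (gt_eqF x0) (gt_eqF y0) -expRD; congr expR; ring.
have h1 := expR_ge1Dx ((s - 1) * (ln x - ln y)).
have h2 : x^-1 <= ln x - ln y by exact: invS_le_ln.
have h3 : (s - 1) * x^-1 <= (s - 1) * (ln x - ln y) by rewrite ler_pM2l.
have h4 : 0 <= x `^ (1 - s) := powR_ge0 _ _.
rewrite mulrCA -[X in _ <= _ - X]mulr1 -mulrBr ler_wpM2l//.
by rewrite lerBrDl (le_trans _ h1)// lerD2l.
Qed.

Lemma harmonic_bound (q : R) : 1 <= q -> exists C : R, 0 < C /\
  forall m, (0 < m)%N -> \sum_(k < m) k.+1%:R `^ (- (q / 2)) <=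
    C * (m%:R `^ Num.max (1 - q / 2) 0 * (1 + ln m%:R) ^+ (q == 2)).
Proof.
move=> q1; have [q2|q2|->] := ltgtP q 2.
- exists (1 - q / 2)^-1; split; first by rewrite invr_gt0; lra.
  move=> m m0; rewrite expr0 mulr1 max_l; last by lra.
  by apply: sum_powR_lt1; lra.
- exists (1 + (q / 2 - 1)^-1); split; first by rewrite addr_gt0// invr_gt0; lra.
  move=> m m0; rewrite expr0 mulr1 max_r; last by lra.
  by rewrite powRr0 mulr1; apply: sum_powR_gt1; lra.
- exists 1; split => // m m0; rewrite divff// subrr max_r// powRr0 !mul1r expr1.
  exact: sum_powR_eq1.
Qed.

End HarmonicSums.

(** Points with distinct levels inject into a product of intervals, over which the
    sum of a product factors. *)
Lemma sum_levels (R : realType) (I : finType) d (B : {set I})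
    (l : I -> 'I_d -> nat) (m : 'I_d -> nat) (h : nat -> R) :
  (forall k, 0 <= h k) ->
  {in B &, forall i k, (forall j, l i j = l k j) -> i = k} ->
  {in B, forall i j, l i j < m j}%N ->
  \sum_(i in B) \prod_j h (l i j) <= \prod_j \sum_(k < m j) h k.
Proof.
move=> h0 l_inj lm; pose L := (\sum_j m j)%N.
have mL j : (m j <= L.+1)%N by rewrite /L (bigD1 j)//= -addnS leq_addr.
pose g i : {ffun 'I_d -> 'I_L.+1} := [ffun j => inord (l i j)].
have gE i j : i \in B -> g i j = l i j :> nat.
  by move=> iB; rewrite ffunE inordK// (leq_trans (lm i iB j)).
have g_inj : {in B &, injective g}.
  move=> i k iB kB gik; apply: l_inj => // j.
  by rewrite -(gE i)// -(gE k)// gik.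
have -> : \prod_j \sum_(k < m j) h k =
    \prod_j \sum_(k : 'I_L.+1 | (k < m j)%N) h k.
  by apply: eq_bigr => j _; rewrite (big_ord_widen _ h (mL j)).
rewrite (bigA_distr_big_dep (fun j (k : 'I_L.+1) => (k < m j)%N) (fun j (k : 'I_L.+1) => h k)).
have -> : \sum_(i in B) \prod_j h (l i j) =
    \sum_(e in [set g i | i in B]%SET) \prod_j h (e j).
  rewrite big_imset//=; apply: eq_bigr => i iB; apply: eq_bigr => j _.
  by rewrite gE.
rewrite [leLHS]big_mkcond [leRHS]big_mkcond; apply: ler_sum => e _.
have prod0 : 0 <= \prod_j h (e j) by apply: prodr_ge0.
case: ifPn => [/imsetP[i iB ->]|_]; last by case: ifP.
case: ifPn => // /negP[]; apply/familyP => j.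
by rewrite unfold_in /= gE// lm.
Qed.

Section LogPlus.
Context {R : realType}.
Implicit Types t u : R.

Lemma log_plus_ge1 t : 1 <= log_plus t.
Proof. by rewrite /log_plus le_max lexx. Qed.

Lemma ln_le_log_plus t : ln t <= log_plus t.
Proof. by rewrite /log_plus le_max lexx orbT. Qed.

Lemma le_log_plus t u : 0 < t -> t <= u -> log_plus t <= log_plus u.
Proof.
move=> t0 tu; rewrite /log_plus ge_max le_max lexx/= le_max.
by rewrite ler_ln ?posrE ?(lt_le_trans t0)// tu orbT.
Qed.

(** Both truncated logarithms are at least 1, so their sum is at most this
    product; the product form survives taking powers. *)
Lemma log_plusM t u : 0 < t -> 0 < u ->
  log_plus (t * u) <= log_plus t * (1 + log_plus u).
Proof.
move=> t0 u0; have h1 := log_plus_ge1 t; have h2 := log_plus_ge1 u.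
have h3 := ln_le_log_plus t; have h4 := ln_le_log_plus u.
rewrite {1}/log_plus lnM ?posrE// ge_max; apply/andP; split; nra.
Qed.

Lemma log_plus_power_le d t : 0 < t ->
  (1 + log_plus t) ^+ d.+1 <= d.+1%:R `^ d.+1%:R * expR 2 * (1 + t).
Proof.
move=> t0; set y := Num.max 0 (ln t).
have y0 : 0 <= y by rewrite /y le_max lexx.
have lty : 1 + log_plus t <= 2 + y.
  rewrite /log_plus /y; case: (leP 1 (ln t)); case: (leP 0 (ln t)); lra.
have ey : expR y <= 1 + t.
  rewrite /y; case: (leP 0 (ln t)) => _; last by rewrite expR0 lerDl ltW.
  by rewrite lnK ?posrE// lerDr.
apply: (@le_trans _ _ ((2 + y) ^+ d.+1)).
  by apply: lerXn2r => //; rewrite nnegrE; have := log_plus_ge1 t; lra.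
rewrite -powR_mulrn; last by lra.
apply: le_trans (powR_le_expR _ _) _ => //; first by lra.
by rewrite expRD -!mulrA ler_wpM2l ?powR_ge0// ler_wpM2l// expR_ge0.
Qed.

End LogPlus.

(** * Summation over the blocks *)

Section BlockSums.
Context {R : realType} {d : nat} {N : 'I_d -> nat}.
Variables (q CH : R).
Hypothesis CH0 : 0 <= CH.
Hypothesis CH_bound : forall m, (0 < m)%N ->
  \sum_(k < m) k.+1%:R `^ (- (q / 2)) <=
    CH * (m%:R `^ Num.max (1 - q / 2) 0 * (1 + ln m%:R) ^+ (q == 2)).
Variables (a b : lattice N).
Hypothesis ab : lle a b.

Let nb : R := #|block a b|%:R.
Let bound : R := (2 * CH) ^+ d *
  (nb `^ Num.max (1 - q / 2) 0 * (log_plus nb ^+ free_dim a b) ^+ (q == 2)).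

Let nbE : nb = \prod_j (side a b j)%:R.
Proof. by rewrite /nb card_block natr_prod. Qed.

Let side_ge1 j : 1 <= (side a b j)%:R :> R.
Proof. by rewrite ler1n side_gt0. Qed.

Let side_le_nb j : (side a b j)%:R <= nb.
Proof.
rewrite nbE (bigD1 j)//= ler_peMr ?ler0n//.
by elim/big_ind: _ => // [u v u1 v1]; rewrite mulr_ege1.
Qed.

(** A side of length 1 contributes the factor [1 + ln 1 = 1]; each of the other
    sides is at most the volume. *)
Let prod_log : \prod_j (1 + ln (side a b j)%:R) <=
  2 ^+ d * log_plus nb ^+ free_dim a b.
Proof.
apply: (@le_trans _ _ (\prod_j (2 * (if (a j < b j)%N then log_plus nb else 1)))).
  apply: ler_prod => j _; apply/andP; split.
    by rewrite addr_ge0// ln_ge0.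
  case: ifPn => [_|ba].
    have h1 := log_plus_ge1 nb.
    suff : ln (side a b j)%:R <= log_plus nb by lra.
    apply: le_trans (ln_le_log_plus _) _; apply: le_log_plus => //.
    by apply: lt_le_trans (side_ge1 j).
  have -> : side a b j = 1%N.
    by have /forallP/(_ j) := ab; rewrite /side; move: ba; clear; lia.
  by rewrite ln1 addr0 mulr1 ler1n.
rewrite big_split/= prodr_const card_ord -big_mkcond/= prodr_const.
by rewrite /free_dim cardsE.
Qed.

Let prod_harmonic :
  \prod_j \sum_(k < side a b j) k.+1%:R `^ (- (q / 2)) <= bound.
Proof.
apply: (@le_trans _ _ (\prod_j (CH * ((side a b j)%:R `^ Num.max (1 - q / 2) 0 *
    (1 + ln (side a b j)%:R) ^+ (q == 2))))).
  apply: ler_prod => j _; rewrite CH_bound ?side_gt0// andbT.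
  by apply: sumr_ge0 => k _; rewrite powR_ge0.
rewrite !big_split/= prodr_const card_ord -powR_prod// -nbE /bound exprMn.
rewrite prodrXl [2 ^+ d * _]mulrC -!mulrA ler_wpM2l ?exprn_ge0//.
rewrite [leRHS]mulrCA ler_wpM2l ?powR_ge0//.
case: eqP => _; last by rewrite !expr0 mulr1 exprn_ege1// ler1n.
by rewrite !expr1.
Qed.

Lemma block_sum_depth :
  \sum_(z in block a b) block_volume z b `^ (- (q / 2)) <= bound.
Proof.
apply: le_trans prod_harmonic.
pose l (z : lattice N) (j : 'I_d) := (b j - z j)%N.
apply: le_trans (sum_levels (l := l) (h := fun k => k.+1%:R `^ (- (q / 2))) _ _ _).
- rewrite le_eqVlt; apply/orP; left; apply/eqP; apply: eq_bigr => z.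
  rewrite inE => /andP[_ /forallP zb].
  rewrite /block_volume natr_prod powR_prod//; apply: eq_bigr => j _.
  by congr (_%:R `^ _); rewrite /side /l subSn// zb.
- by move=> k; rewrite powR_ge0.
- move=> z z'; rewrite !inE => /andP[_ /forallP zb] /andP[_ /forallP zb'] h.
  apply/ffunP => j; apply: val_inj => /=.
  by have := h j; have := zb j; have := zb' j; rewrite /l; clear; lia.
- move=> z; rewrite !inE => /andP[/forallP az /forallP zb] j.
  by have := az j; have := zb j; rewrite /l /side; clear; lia.
Qed.

Lemma block_sum_height :
  \sum_(z in block a b) block_volume a z `^ (- (q / 2)) <= bound.
Proof.
apply: le_trans prod_harmonic.
pose l (z : lattice N) (j : 'I_d) := (z j - a j)%N.
apply: le_trans (sum_levels (l := l) (h := fun k => k.+1%:R `^ (- (q / 2))) _ _ _).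
- rewrite le_eqVlt; apply/orP; left; apply/eqP; apply: eq_bigr => z.
  rewrite inE => /andP[/forallP az _].
  rewrite /block_volume natr_prod powR_prod//; apply: eq_bigr => j _.
  by congr (_%:R `^ _); rewrite /side /l subSn// az.
- by move=> k; rewrite powR_ge0.
- move=> z z'; rewrite !inE => /andP[/forallP az _] /andP[/forallP az' _] h.
  apply/ffunP => j; apply: val_inj => /=.
  by have := h j; have := az j; have := az' j; rewrite /l; clear; lia.
- move=> z; rewrite !inE => /andP[/forallP az /forallP zb] j.
  by have := az j; have := zb j; rewrite /l /side; clear; lia.
Qed.

End BlockSums.

Definition disjoint_const (R : realType) (d : nat) : R :=
  2 * (d%:R `^ d%:R * expR 2 + 1).

(** [t k] is the size of the k-th block relative to the mean size [r = n / K]; its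
    mean is at most 1.  Each summand is at most its value for a block of size [r]
    times a multiple of [1 + t k]: a power with exponent in [0, 1] is at most
    linear, and a power of a logarithm grows more slowly than [1 + t k]. *)
Lemma disjoint_terms_le (R : realType) (q : R) (d K D : nat) (n : R)
    (nb : 'I_K -> R) (s : 'I_K -> nat) :
  1 <= q -> (0 < K)%N -> K%:R <= n -> (forall k, 0 < nb k) ->
  \sum_k nb k <= n -> (forall k, s k <= D)%N -> (D <= d.+1)%N ->
  n^-1 * (\sum_k nb k `^ Num.max (1 - q / 2) 0
            * (log_plus (nb k) ^+ s k) ^+ (q == 2)) <=
  disjoint_const R d.+1 * ((K%:R / n) `^ Num.min 1 (q / 2)
    * (log_plus (n / K%:R) ^+ D) ^+ (q == 2)).
Proof.
move=> q1 K0 Kn nb0 sum_nb sD Dd.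
set g := Num.max (1 - q / 2) 0.
have Kp : 0 < K%:R :> R by rewrite ltr0n.
have n0 : 0 < n by exact: lt_le_trans Kn.
set r := n / K%:R; have r0 : 0 < r by rewrite divr_gt0.
pose t k := nb k / r; have t0 k : 0 < t k by rewrite divr_gt0.
have nbE k : nb k = r * t k by rewrite /t mulrCA mulfV ?mulr1// gt_eqF.
have gE : Num.min 1 (q / 2) = 1 - g.
  by rewrite /g; case: (leP q 2) => h; [rewrite max_l ?min_r|rewrite max_r ?min_l]; lra.
have g01 : 0 <= g <= 1.
  by rewrite /g le_max lexx orbT/= ge_max ler01 andbT; lra.
pose C4 : R := d.+1%:R `^ d.+1%:R * expR 2 + 1.
have C40 : 0 <= d.+1%:R `^ d.+1%:R * expR 2 :> R by rewrite mulr_ge0 ?powR_ge0 ?expR_ge0.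
pose Lr := (log_plus r ^+ D) ^+ (q == 2).
have Lr0 : 0 <= Lr.
  by rewrite /Lr !exprn_ge0// (le_trans _ (log_plus_ge1 r)).
have term k : nb k `^ g * (log_plus (nb k) ^+ s k) ^+ (q == 2) <=
    r `^ g * Lr * (C4 * (1 + t k)).
  have [q2|q2] := eqVneq q 2.
    rewrite /Lr /g q2 divff// subrr maxxx !powRr0 !mul1r eqxx !expr1.
    apply: (@le_trans _ _ (log_plus (nb k) ^+ D)).
      by apply: ler_weXn2l => //; exact: log_plus_ge1.
    apply: (@le_trans _ _ ((log_plus r * (1 + log_plus (t k))) ^+ D)).
      have h1 := log_plus_ge1 (nb k); have h2 := log_plus_ge1 (t k).
      have h3 := log_plus_ge1 r.
      apply: lerXn2r; rewrite ?nnegrE; [lra|nra|].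
      by rewrite nbE; exact: log_plusM.
    rewrite exprMn ler_wpM2l ?exprn_ge0 ?(le_trans _ (log_plus_ge1 r))//.
    apply: (@le_trans _ _ ((1 + log_plus (t k)) ^+ d.+1)).
      by apply: ler_weXn2l => //; have := log_plus_ge1 (t k); lra.
    apply: le_trans (log_plus_power_le d (t0 k)) _.
    by rewrite /C4 ler_wpM2r ?lerDl// addr_ge0// ltW.
  rewrite /Lr (negbTE q2) !expr0 !mulr1 nbE powRM ?(ltW r0) ?(ltW (t0 k))// ler_wpM2l ?powR_ge0//.
  apply: (@le_trans _ _ (1 + t k)).
    have [h|h] := leP (t k) 1.
      apply: (@le_trans _ _ (1 `^ g)); last by rewrite powR1 lerDl ltW.
      by apply: ler_powR_base => //; [case/andP: g01|exact: ltW].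
    apply: (@le_trans _ _ (t k)); last by rewrite lerDr.
    by apply: ler1_powR; [exact: ltW | case/andP: g01].
  by rewrite /C4 ler_peMl ?lerDr// addr_ge0// ltW.
have sum_t : \sum_k (1 + t k) <= 2 * K%:R.
  rewrite big_split/= sumr_const card_ord -mulr_suml.
  have : (\sum_k nb k) / r <= K%:R.
    rewrite ler_pdivrMr// /r mulrCA mulfV ?mulr1// gt_eqF//.
  by rewrite -[1 *+ K]/(K%:R); lra.
apply: (@le_trans _ _ (n^-1 * (r `^ g * Lr * (C4 * (2 * K%:R))))).
  rewrite ler_wpM2l ?invr_ge0 ?(ltW n0)//.
  apply: le_trans (ler_sum _ (fun k _ => term k)) _.
  rewrite -mulr_sumr -mulr_sumr ler_wpM2l ?mulr_ge0 ?powR_ge0//.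
  by rewrite ler_wpM2l// addr_ge0.
have Kr : K%:R / n = r^-1 by rewrite /r invf_div.
have -> : (K%:R / n) `^ Num.min 1 (q / 2) = r^-1 * r `^ g.
  rewrite gE Kr -powR_inv1 ?(ltW r0)// -powRrM -powRD; last by rewrite (gt_eqF r0) implybT.
  by congr (_ `^ _); ring.
rewrite -/Lr -Kr /disjoint_const -/C4 le_eqVlt; apply/orP; left; apply/eqP; ring.
Qed.

(** * The risk bounds *)

Lemma risk_le dsp (T : measurableType dsp) (R : realType) (P : probability T R)
    d (N : 'I_d -> nat) n (x : 'I_n -> lattice N) (q : R)
    (fhat : lattice N -> T -> R) (f G : lattice N -> R) :
  bijective x ->
  (forall z, ('E_P[fun w => (`|fhat z w - f z| `^ q)%R] <= (G z)%:E)%E) ->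
  (risk P x q fhat f <= (n%:R^-1 * \sum_z G z)%:E)%E.
Proof.
move=> x_bij EG; rewrite /risk EFinM.
rewrite lee_wpmul2l ?lee_fin ?invr_ge0//.
rewrite (reindex x) /=; last by case: x_bij => y xy yx; exists y => i _.
by rewrite -sumEFin; apply: lee_sum => i _.
Qed.

Theorem theorem4 (R : realType) (q : R) (d : nat) (hq : 1 <= q)
    (hd : (0 < d)%N) :
  exists C : R, 0 < C /\
  forall (dsp : measure_display) (T : measurableType dsp) (P : probability T R)
    (N : 'I_d -> nat) (hN : forall j, (0 < N j)%N)
    (x : 'I_(lattice_size N) -> lattice N) (hx : bijective x)
    (f : lattice N -> R) (eps : 'I_(lattice_size N) -> {RV P >-> R})
    (fhat : lattice N -> {RV P >-> R}) (sigma : R) (hsigma : 0 <= sigma)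
    (hindep : mutually_independent P (fun i => eps i : T -> R))
    (hmean : forall i, ('E_P[eps i] = 0)%E)
    (hmom : forall i, ('E_P[fun w => (`|eps i w| `^ Num.max q 2)%R]
                         <= (sigma `^ Num.max q 2)%:E)%E)
    (hfhat : block_estimator x f (fun i => eps i : T -> R)
               (fun z => fhat z : T -> R))
    (hf : forall u v, lle u v -> f u <= f v)
    (K : nat) (hK : (K <= lattice_size N)%N) (a b : 'I_K -> lattice N)
    (hab : forall k, lle (a k) (b k))
    (hcover : \bigcup_(k < K) block (a k) (b k) = [set: lattice N])
    (hconst : forall k, f (a k) = f (b k)),
  let n : R := (lattice_size N)%:R in
  let nb k : R := (block_count x (a k) (b k))%:R in
  let s k := free_dim (a k) (b k) in
  let rho := risk P x q (fun z => fhat z : T -> R) f in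
  (rho <= (C * (sigma `^ q *
     Num.min 1 (n^-1 * \sum_(k < K)
       nb k `^ Num.max (1 - q / 2) 0
         * (log_plus (nb k) ^+ s k) ^+ (q == 2))))%:E)%E
  /\
  ((forall k l, k != l -> [disjoint block (a k) (b k) & block (a l) (b l)]) ->
   (rho <= (C * (sigma `^ q *
     Num.min 1 ((K%:R / n) `^ Num.min 1 (q / 2)
       * (log_plus (n / K%:R) ^+ (\max_(k < K) s k)%N) ^+ (q == 2))))%:E)%E).
Proof.
have [CH [CH0 CH_bound]] := harmonic_bound hq.
pose C1 : R := 2 * (1 + average_const (Num.max q 2) d).
pose C2 : R := (2 * CH) ^+ d.
pose C3 : R := disjoint_const R d.
have C10 : 0 < C1.
  by rewrite mulr_gt0// ltr_pwDl// mulr_ge0 ?box_const_ge0 ?exprn_ge0 ?mulr_ge0 ?powR_ge0.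
have C20 : 0 <= C2 by rewrite exprn_ge0// mulr_ge0// ltW.
have C30 : 0 <= C3.
  by rewrite /C3 /disjoint_const mulr_ge0// addr_ge0// mulr_ge0 ?powR_ge0 ?expR_ge0.
exists (C1 * (1 + C2 * (1 + C3))); split.
  by rewrite mulr_gt0// ltr_pwDl// mulr_ge0// addr_ge0.
move=> dsp T P N hN x hx f eps fhat sigma hsigma hindep hmean hmom hfhat hf.
move=> K hK a b hab hcover hconst n nb s rho.
have n0 : 0 < n by rewrite ltr0n prodn_gt0.
have S0 : 0 <= sigma `^ q by exact: powR_ge0.
pose Ez z := 'E_P[fun w => (`|fhat z w - f z| `^ q)%R]%E.
(* The factor 2 in [C1] allows for both anchors of a block. *)
pose g z k : R := C1 / 2 * (sigma `^ q * (block_volume z (b k) `^ (- (q / 2)) +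
                                   block_volume (a k) z `^ (- (q / 2)))).
have Eg z k : z \in block (a k) (b k) -> (Ez z <= (g z k)%:E)%E.
  move=> zk; rewrite /g (_ : C1 / 2 = 1 + average_const (Num.max q 2) d); last first.
    by rewrite /C1; field.
  exact: (pointwise_risk hq hsigma hx hindep hmean hmom hf hfhat (hconst k) zk).
have g0 z k : 0 <= g z k.
  by rewrite mulr_ge0 ?divr_ge0 ?(ltW C10)// mulr_ge0// addr_ge0 ?powR_ge0.
have in_block z : exists k, z \in block (a k) (b k).
  have : z \in \bigcup_(k < K) block (a k) (b k) by rewrite hcover finset.in_setT.
  by move=> /bigcupP[k _ zk]; exists k.
have volume_le1 u v : lle u v -> (block_volume u v : R) `^ (- (q / 2)) <= 1.
  move=> uv; have V1 : 1 <= block_volume u v :> R.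
    by rewrite ler1n prodn_gt0// => j; exact: side_gt0.
  have Vq1 : 1 <= (block_volume u v : R) `^ (q / 2).
    apply: (@le_trans _ _ (1 `^ (q / 2))); first by rewrite powR1.
    by apply: ler_powR_base => //; rewrite divr_ge0// (le_trans _ hq).
  by rewrite powRN invf_le1// (lt_le_trans ltr01).
have card_lattice : #|[set: lattice N]%SET| = lattice_size N.
  by rewrite cardsT -(bij_eq_card hx) card_ord.
have trivial_bound : (rho <= (C1 * sigma `^ q)%:E)%E.
  apply: le_trans (risk_le (G := fun=> C1 * sigma `^ q) hx _) _ => [z|].
    have [k zk] := in_block z; apply: le_trans (Eg z k zk) _.
    have /andP[az zb] : lle (a k) z && lle z (b k) by move: zk; rewrite inE.
    have -> : C1 * sigma `^ q = C1 / 2 * (sigma `^ q * (1 + 1)) by field.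
    rewrite lee_fin ler_wpM2l ?divr_ge0 ?(ltW C10)// ler_wpM2l// lerD//;
    exact: volume_le1.
  rewrite lee_fin sumr_const -cardsT card_lattice -/n.
  by rewrite -[X in _ * X]mulr_natl mulKf// gt_eqF.
pose term k := nb k `^ Num.max (1 - q / 2) 0 * (log_plus (nb k) ^+ s k) ^+ (q == 2).
have term0 k : 0 <= term k.
  by rewrite mulr_ge0 ?powR_ge0// !exprn_ge0// (le_trans _ (log_plus_ge1 _)).
(* The blocks may overlap, so the bounds of all blocks containing a point are
   added up. *)
have block_bound : (rho <= (C1 * C2 * sigma `^ q * (n^-1 * \sum_k term k))%:E)%E.
  apply: le_trans (risk_le (G := fun z => \sum_(k | z \in block (a k) (b k)) g z k) hx _) _ => [z|].
    have [k zk] := in_block z; apply: le_trans (Eg z k zk) _.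
    by rewrite lee_fin (bigD1 k)//= lerDl sumr_ge0.
  rewrite lee_fin mulrCA ler_wpM2l ?invr_ge0 ?(ltW n0)//.
  rewrite (exchange_big_dep predT)//= mulr_sumr; apply: ler_sum => k _.
  rewrite -!mulr_sumr big_split/=.
  have h1 := block_sum_depth (ltW CH0) CH_bound (hab k).
  have h2 := block_sum_height (ltW CH0) CH_bound (hab k).
  have -> : C1 * C2 * sigma `^ q * term k =
     C1 / 2 * (sigma `^ q * (C2 * term k + C2 * term k)) by field.
  rewrite ler_wpM2l ?divr_ge0 ?(ltW C10)// ler_wpM2l// lerD//.
    by rewrite /term /nb block_countE.
  by rewrite /term /nb block_countE.
have combine X : 0 <= X -> (rho <= (C1 * (C2 * (1 + C3)) * sigma `^ q * X)%:E)%E ->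
    (rho <= (C1 * (1 + C2 * (1 + C3)) * (sigma `^ q * Num.min 1 X))%:E)%E.
  move=> X0 rhoX; have [X1|X1] := leP 1 X.
    apply: le_trans trivial_bound _; rewrite lee_fin mulr1 ler_wpM2r//.
    by rewrite ler_peMr ?(ltW C10)// lerDl mulr_ge0// addr_ge0.
  apply: le_trans rhoX _; rewrite lee_fin -mulrA ler_wpM2r ?mulr_ge0//.
  by rewrite ler_wpM2l ?(ltW C10)// lerDr.
split.
  have X0 : 0 <= n^-1 * \sum_k term k.
    by apply: mulr_ge0; [rewrite invr_ge0 ltW|exact: sumr_ge0].
  apply: (combine _ X0); apply: le_trans block_bound _; rewrite lee_fin.
  rewrite ler_wpM2r// ler_wpM2r//.
  by rewrite ler_wpM2l ?(ltW C10)// ler_peMr// lerDl.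
move=> disj; apply: combine.
  by rewrite mulr_ge0 ?powR_ge0// !exprn_ge0// (le_trans _ (log_plus_ge1 _)).
have K0 : (0 < K)%N.
  have [k _] := in_block (x (Ordinal (prodn_gt0 (P := xpredT) hN))).
  exact: leq_ltn_trans (ltn_ord k).
have sum_nb : \sum_k nb k <= n.
  rewrite /nb /n; under eq_bigr do rewrite block_countE// -sum1_card.
  rewrite -natr_sum ler_nat -partition_disjoint_bigcup// hcover.
  by rewrite sum1_card card_lattice.
apply: le_trans block_bound _; rewrite lee_fin.
have sD k : (s k <= \max_(k < K) s k)%N by exact: (leq_bigmax k).
have Dd : (\max_(k < K) s k <= d.-1.+1)%N.
  rewrite prednK//; apply/bigmax_leqP => k _.
  by rewrite -[leqRHS](card_ord d); exact: max_card.
have Kn : K%:R <= n by rewrite ler_nat.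
have nb0 k : 0 < nb k by rewrite ltr0n block_count_gt0.
have := disjoint_terms_le hq K0 Kn nb0 sum_nb sD Dd.
rewrite prednK// -/C3.
set Y := _ * _ ^+ (q == 2); move=> H.
have Y0 : 0 <= Y.
  by rewrite mulr_ge0 ?powR_ge0// !exprn_ge0// (le_trans _ (log_plus_ge1 _)).
apply: (@le_trans _ _ (C1 * C2 * sigma `^ q * (C3 * Y))).
  by apply: ler_wpM2l H; rewrite mulr_ge0// mulr_ge0// (ltW C10).
have -> : C1 * C2 * sigma `^ q * (C3 * Y) = C1 * (C2 * C3) * sigma `^ q * Y by ring.
rewrite ler_wpM2r// ler_wpM2r// ler_wpM2l ?(ltW C10)// ler_wpM2l//.
by rewrite lerDr.
Qed.
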